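(* Let $p$ be a prime, $r\ge 1$ an integer, $q=p^r$, and let $(\beta_1,\ldots,\beta_r)$ be an ordered basis of $\mathbb{F}_q$ over $\mathbb{F}_p$, with associated sum-of-digits function $T$. Assume $1\le d<p$ and let $f_d(X)=X^d\in\mathbb{F}_q[X]$. For any integer $s$ with $1\le s\le d$, any $\mathcal{A}\subset\mathbb{F}_q$ of size $s$ and any $\underline{c}\in\mathbb{F}_p^s$ we have $$\left||\mathcal{T}(\underline{c},\mathcal{A},f_d)|-p^{r-s}\right|\le (d-1)q^{1/2},$$ and for any integer $s$ with $q\ge s>d$ there is $\mathcal{A}\subset\mathbb{F}_q$ of size $s$ and a vector $\underline{c}\in\mathbb{F}_p^s$ for which $\mathcal{T}(\underline{c},\mathcal{A},f_d)$ is empty.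
   Context: For $\xi=\sum_{i=1}^r x_i\beta_i\in\mathbb{F}_q$ with $x_i\in\mathbb{F}_p$, the Thue-Morse or sum-of-digits function with respect to the basis $(\beta_1,\ldots,\beta_r)$ is $T(\xi)=\sum_{i=1}^r x_i\in\mathbb{F}_p$. For an integer $s$ with $1\le s\le q$, a set $\mathcal{A}=\{\alpha_1,\ldots,\alpha_s\}\subset\mathbb{F}_q$ of $s$ distinct elements, a polynomial $f(X)\in\mathbb{F}_q[X]$ and a vector $\underline{c}=(c_1,\ldots,c_s)\in\mathbb{F}_p^s$, put $$\mathcal{T}(\underline{c},\mathcal{A},f)=\{\xi\in\mathbb{F}_q: T(f(\xi+\alpha_i))=c_i,\ i=1,\ldots,s\}.$$ $|\cdot|$ of a set denotes its cardinality, and $p^{r-s}$ is a rational number (possibly less than $1$). *)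

(* Defs.v *)
From HB Require Import structures.
From mathcomp Require Import all_boot all_order all_algebra all_field.

Set Implicit Arguments.
Unset Strict Implicit.
Unset Printing Implicit Defensive.

Import Order.TTheory GRing.Theory Num.Theory.
Local Open Scope ring_scope.

(* [pPrimeCharType charFp] is the field F itself, with its canonical structure
   of vector space over its prime field 'F_p.  The linear form [coord b i] is
   the i-th coordinate in b as soon as b is a basis. *)
Definition digit_sum (p r : nat) (F : finFieldType) (charFp : p \in [pchar F])
    (b : r.-tuple (pPrimeCharType charFp)) (xi : F) : 'F_p :=
  \sum_(i < r) coord b i (xi : pPrimeCharType charFp).

Lemma digit_sumE (p r : nat) (F : finFieldType) (charFp : p \in [pchar F])
    (b : r.-tuple (pPrimeCharType charFp)) (x : 'I_r -> 'F_p) :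
  basis_of fullv b -> digit_sum b (\sum_(i < r) x i *: b`_i) = \sum_(i < r) x i.
Proof.
move=> /basis_free bfree; apply: eq_bigr => i _; exact: coord_sum_free.
Qed.

(* The s-element set A is given by an enumeration alpha of its elements
   (repetition-free when [uniq alpha]), which fixes the matching of its
   elements with the entries of c. *)
Definition thue_morse_set (p r s : nat) (F : finFieldType)
    (charFp : p \in [pchar F]) (b : r.-tuple (pPrimeCharType charFp))
    (c : s.-tuple 'F_p) (alpha : s.-tuple F) (f : {poly F}) : {set F} :=
  [set xi : F |
    [forall i : 'I_s, digit_sum b f.[xi + tnth alpha i] == tnth c i]].

(* Main.v *)
Require Import Defs.
From HB Require Import structures.
From mathcomp Require Import all_boot all_order all_algebra all_field.
From mathcomp Require Import zify ring.

Set Implicit Arguments.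
Unset Strict Implicit.
Unset Printing Implicit Defensive.

Import Order.TTheory GRing.Theory Num.Theory.
Local Open Scope ring_scope.

(* Writing [T = Tr (gam * _)], orthogonality of characters turns the count into an
   average of the sums of [psi (Tr (g x))] over [x] in [F_q], for the polynomials
   [g = gam * sum_i y_i (X + alpha_i)^d].  These are nonconstant for [y <> 0] and
   [s <= d], by interpolation at the [alpha_i], and Weil's bound applies.

   Weil's bound is obtained inside an algebraic closure [K] of [F_q].  Let [S_n] be the
   sum of [psi (Tr (g x))] over [F_(q^n)].  Bombieri's form of Stepanov's method on the
   curve [y^p = y + g x] gives [S_(2k) = O(q^k)].  On the other hand the sums [c_m] of
   the multiplicative function [h |-> psi (Tr (sum of g over the roots of h))] over the
   monic [h] of degree [m] satisfy [m c_m = sum_j S_j c_(m-j)], and [c_m = 0] for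
   [m >= deg g], since by Newton's identities the coefficient of index [deg g] of [h]
   enters linearly.  Hence [S_n = - sum_i w_i^n] with [deg g - 1] numbers [w_i], and the
   crude bound on the [S_(2k)] forces [|w_i| <= sqrt q].

   For [s > d], take [0, ..., d] among the [alpha_i]: as a function of [i] in [F_p],
   [T ((xi + i)^d)] is a polynomial of degree at most [d] whose coefficient of index [d]
   is [T 1]; it cannot agree with [(T 1 + 1) i^d] at [d + 1] points. *)

(** * Frobenius powers and Artin-Schreier equations *)

Lemma natr_eq_pchar (R : nzRingType) p (charRp : p \in [pchar R]) a b :
  (a%:R == b%:R :> R) = (a == b %[mod p]).
Proof.
wlog ba : a b / (b <= a)%N => [hw|].
  by case/orP: (leq_total b a) => /hw // E; rewrite eq_sym E eq_sym.
by rewrite -subr_eq0 -natrB // -(dvdn_pcharf charRp) eqn_mod_dvd.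
Qed.

Section FrobeniusPowers.

Variables (R : comNzRingType) (p : nat) (charRp : p \in [pchar R]).

Lemma exprD_pchar n (x y : R) : (x + y) ^+ (p ^ n) = x ^+ (p ^ n) + y ^+ (p ^ n).
Proof. by apply: exprDn_pchar; rewrite pnatX pnatE ?charRp ?(pcharf_prime charRp). Qed.

Lemma expr0_pchar n : (0 : R) ^+ (p ^ n) = 0.
Proof. by rewrite expr0n expn_eq0 eqn0Ngt prime_gt0 ?(pcharf_prime charRp). Qed.

Lemma expr_sum_pchar n I (r : seq I) (P : pred I) (F : I -> R) :
  (\sum_(i <- r | P i) F i) ^+ (p ^ n) = \sum_(i <- r | P i) F i ^+ (p ^ n).
Proof. exact: (big_morph (fun x => x ^+ (p ^ n)) (exprD_pchar n) (expr0_pchar n)). Qed.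

Lemma exprN_pchar n (x : R) : (- x) ^+ (p ^ n) = - x ^+ (p ^ n).
Proof. by apply/eqP; rewrite -subr_eq0 opprK -exprD_pchar addNr expr0_pchar. Qed.

Lemma exprB_pchar n (x y : R) : (x - y) ^+ (p ^ n) = x ^+ (p ^ n) - y ^+ (p ^ n).
Proof. by rewrite exprD_pchar exprN_pchar. Qed.

Lemma expr_nat_pchar n a : (a%:R : R) ^+ (p ^ n) = a%:R.
Proof.
by elim: a => [|a IHa]; rewrite ?expr0_pchar // -addn1 natrD exprD_pchar IHa expr1n.
Qed.

Definition abs_trace (n : nat) (y : R) : R := \sum_(i < n) y ^+ (p ^ i).

Lemma abs_traceD n x y : abs_trace n (x + y) = abs_trace n x + abs_trace n y.
Proof. by rewrite -big_split; apply: eq_bigr => i _; rewrite exprD_pchar. Qed.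

Lemma abs_trace0 n : abs_trace n 0 = 0.
Proof. by apply: big1 => i _; rewrite expr0_pchar. Qed.

Lemma abs_trace_sum n I (r : seq I) (P : pred I) (F : I -> R) :
  abs_trace n (\sum_(i <- r | P i) F i) = \sum_(i <- r | P i) abs_trace n (F i).
Proof. exact: (big_morph _ (abs_traceD n) (abs_trace0 n)). Qed.

Lemma abs_traceN n x : abs_trace n (- x) = - abs_trace n x.
Proof. by rewrite -sumrN; apply: eq_bigr => i _; rewrite exprN_pchar. Qed.

Lemma abs_traceB n x y : abs_trace n (x - y) = abs_trace n x - abs_trace n y.
Proof. by rewrite abs_traceD abs_traceN. Qed.

Lemma abs_traceMn n a x : abs_trace n (a%:R * x) = a%:R * abs_trace n x.
Proof.
by rewrite mulr_sumr; apply: eq_bigr => i _; rewrite exprMn expr_nat_pchar.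
Qed.

Lemma abs_traceS n x : abs_trace n.+1 x = x + abs_trace n x ^+ p.
Proof.
rewrite /abs_trace big_ord_recl expn0 expr1; congr (_ + _).
rewrite -[p in RHS]expn1 expr_sum_pchar; apply: eq_bigr => i _.
by rewrite -exprM expn1 /= expnSr.
Qed.

Lemma abs_trace_expr n x : x ^+ (p ^ n) = x -> abs_trace n x ^+ p = abs_trace n x.
Proof.
move=> xE; apply: (addrI x); rewrite -abs_traceS /abs_trace big_ord_recr /=.
by rewrite xE addrC.
Qed.

(** Transitivity of the trace: the exponents below [n * j] are cut into [j] blocks of length [n]. *)
Lemma abs_trace_mul n j x :
  abs_trace (n * j) x = abs_trace n (\sum_(i < j) x ^+ ((p ^ n) ^ i)).
Proof.
rewrite abs_trace_sum; elim: j => [|j IHj]; first by rewrite muln0 /abs_trace !big_ord0.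
rewrite big_ord_recr /= -IHj mulnS addnC /abs_trace big_split_ord /=.
congr (_ + _); apply: eq_bigr => i _.
by rewrite -expnM -exprM -expnD.
Qed.

(** Raising to the [p]-th power turns [y] into [y + a] and a partial trace [t] into [t ^+ p], and
    [a + t ^+ p] is the next partial trace. *)
Lemma artin_schreier_iter n (y a : R) :
  y ^+ p = y + a -> y ^+ (p ^ n) = y + abs_trace n a.
Proof.
move=> yE; elim: n => [|n IHn]; first by rewrite expr1 /abs_trace big_ord0 addr0.
rewrite expnSr exprM IHn -[p in LHS]expn1 exprD_pchar expn1 yE -addrA; congr (_ + _).
by rewrite -abs_traceS.
Qed.

End FrobeniusPowers.

(** * Roots and Artin-Schreier polynomials over an algebraically closed field *)

Section ClosedRoots.

Variable K : closedFieldType.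

Definition proots (g : {poly K}) : seq K := sval (closed_field_poly_normal g).

Lemma proots_monic (g : {poly K}) :
  g \is monic -> \prod_(z <- proots g) ('X - z%:P) = g.
Proof.
rewrite /proots => /monicP mong; case: closed_field_poly_normal => s /= gE.
by rewrite [RHS]gE mong scale1r.
Qed.

Lemma mem_proots (g : {poly K}) x : g \is monic -> (x \in proots g) = root g x.
Proof. by move=> mong; rewrite -[in RHS](proots_monic mong) root_prod_XsubC. Qed.

Lemma size_proots (g : {poly K}) : g \is monic -> size g = (size (proots g)).+1.
Proof. by move=> mong; rewrite -[in LHS](proots_monic mong) size_prod_XsubC. Qed.

Lemma closed_exprX_root n (a : K) : (0 < n)%N -> exists b, b ^+ n = a.
Proof.
move=> n_gt0; have [b] := @solve_monicpoly K n (fun i => if i == 0%N then a else 0) n_gt0.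
case: n n_gt0 => // n _; rewrite big_ord_recl /= mulr1 big1 => [|i _].
  by move=> bE; exists b; rewrite bE addr0.
by rewrite mul0r.
Qed.

Variables (p : nat) (charKp : p \in [pchar K]).

Let p_gt1 : (1 < p)%N. Proof. exact: prime_gt1 (pcharf_prime charKp). Qed.

Definition artin_schreier_poly n (a : K) : {poly K} := 'X^(p ^ n) - 'X - a%:P.

Lemma artin_schreier_poly_monic n a : (0 < n)%N ->
  size (artin_schreier_poly n a) = (p ^ n).+1 /\ artin_schreier_poly n a \is monic.
Proof.
move=> n_gt0; have pn_gt1: (1 < p ^ n)%N by rewrite -{1}(expn0 p) ltn_exp2l.
have szl: (size ('X + a%:P : {poly K})%R < size ('X^(p ^ n) : {poly K})%R)%N.
  by rewrite size_XaddC size_polyXn.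
rewrite /artin_schreier_poly -addrA -opprD; split.
  by rewrite size_polyDl ?size_polyN // size_polyXn.
by rewrite monicE lead_coefDl ?size_polyN // lead_coefXn.
Qed.

(** In characteristic [p] the derivative is the constant [-1], so the polynomial is separable. *)
Lemma artin_schreier_roots_uniq n a : (0 < n)%N ->
  uniq (proots (artin_schreier_poly n a)).
Proof.
move=> n_gt0; rewrite -separable_prod_XsubC proots_monic; last first.
  by case: (artin_schreier_poly_monic a n_gt0).
rewrite unlock /artin_schreier_poly !derivB derivXn derivC subr0 derivX.
have -> : ('X^((p ^ n).-1) *+ (p ^ n) : {poly K}) = 0.
  rewrite -mulr_natr natrX (pcharf0 (_ : p \in [pchar {poly K}])) ?pchar_poly //.
  by rewrite expr0n eqn0Ngt n_gt0 mulr0.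
by rewrite sub0r -[- 1]scaleN1r coprimepZr ?oppr_eq0 ?oner_eq0 // coprimep1.
Qed.

Lemma artin_schreier_root n (a x : K) :
  root (artin_schreier_poly n a) x = (x ^+ (p ^ n) == x + a).
Proof.
by rewrite rootE /artin_schreier_poly !hornerE -addrA -opprD subr_eq0.
Qed.

Lemma artin_schreier_rootsP n (a : K) : (0 < n)%N ->
  {s : seq K | [/\ uniq s, size s = (p ^ n)%N &
     forall x, (x \in s) = (x ^+ (p ^ n) == x + a)]}.
Proof.
move=> n_gt0; have [sz mon] := artin_schreier_poly_monic a n_gt0.
exists (proots (artin_schreier_poly n a)); split=> [||x].
- exact: artin_schreier_roots_uniq.
- by apply/eqP; rewrite -eqSS -size_proots // sz.
- by rewrite mem_proots // artin_schreier_root.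
Qed.

(** The trace is a nonconstant polynomial function on a closed field. This later moves any fibre of
    the trace to the fibre over [0]. *)
Lemma abs_trace_surj n (c : K) : (0 < n)%N -> exists a, abs_trace p n a = c.
Proof.
case: n => // n _; case: n => [|n].
  by exists c; rewrite /abs_trace big_ord1 expr1.
pose P := \sum_(i < n.+2) 'X^(p ^ i) : {poly K}.
have szP: (1 < size (P - c%:P)%R)%N.
  rewrite /P big_ord_recr /= addrAC addrC size_polyDl size_polyXn.
    by rewrite ltnS expn_gt0 ltnW.
  rewrite ltnS (leq_trans (size_polyD _ _)) // size_polyN geq_max size_polyC.
  apply/andP; split; last by rewrite (leq_trans (leq_b1 _)) // expn_gt0 ltnW.
  apply: (leq_trans (size_sum _ _ _)); apply/bigmax_leqP => i _.
  by rewrite size_polyXn ltn_exp2l.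
have [a /rootP] := closed_rootP (P - c%:P) (negbT (gtn_eqF szP)).
rewrite hornerD hornerN hornerC horner_sum => /eqP; rewrite subr_eq0 => /eqP aE.
by exists a; rewrite -aE; apply: eq_bigr => i _; rewrite hornerXn.
Qed.

End ClosedRoots.

(** * Weighted degrees and reduction on an Artin-Schreier curve *)

Lemma coefM_top (R : nzRingType) (u v : nat) (g h : {poly R}) :
  (size g <= u.+1)%N -> (size h <= v.+1)%N -> (g * h)`_(u + v) = g`_u * h`_v.
Proof.
move=> szg szh; have ult: (u < (u + v).+1)%N by rewrite ltnS leq_addr.
rewrite coefM (bigD1 (Ordinal ult)) //= addKn big1 ?addr0 // => i iNu.
have [iu|ui] := leqP i u; last by rewrite (nth_default _ (leq_trans szg ui)) mul0r.
rewrite [X in _ * X]nth_default ?mulr0 // (leq_trans szh) //.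
have: (i < u)%N by rewrite ltn_neqAle iu andbT; apply: contraNneq iNu => ui; apply/eqP/val_inj.
by lia.
Qed.

Section WeightedDegree.

Variables (K : fieldType) (p d : nat).

(* Bivariate polynomials are polynomials in [y] over polynomials in [x]; [x] has
   weight [p] and [y] has weight [d]. *)
Definition wdeg_le (W : {poly {poly K}}) (w : nat) :=
  forall i j, (w < p * i + d * j)%N -> W`_j`_i = 0.

Lemma wdeg_le_trans W w w' : wdeg_le W w -> (w <= w')%N -> wdeg_le W w'.
Proof. by move=> Ww ww' i j wij; apply: Ww; apply: leq_ltn_trans wij. Qed.

Lemma wdeg_leD U V w : wdeg_le U w -> wdeg_le V w -> wdeg_le (U + V) w.
Proof. by move=> Uw Vw i j wij; rewrite !coefD Uw ?Vw ?addr0. Qed.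

Lemma wdeg_leN U w : wdeg_le U w -> wdeg_le (- U) w.
Proof. by move=> Uw i j wij; rewrite !coefN Uw ?oppr0. Qed.

Lemma wdeg_leM U V u v : wdeg_le U u -> wdeg_le V v -> wdeg_le (U * V) (u + v).
Proof.
move=> Uu Vv i j wij; rewrite coefM coef_sum big1 // => k _.
rewrite coefM big1 // => l _; have := ltn_ord k; have := ltn_ord l; rewrite !ltnS => li kj.
have [ult|uge] := ltnP u (p * l + d * k); first by rewrite Uu ?mul0r.
rewrite Vv ?mulr0 // -(ltn_add2l u) (leq_trans wij) //.
have pli: (p * l <= p * i)%N by rewrite leq_mul2l li orbT.
have dkj: (d * k <= d * j)%N by rewrite leq_mul2l kj orbT.
by rewrite !mulnBr; lia.
Qed.

Lemma wdeg_le_exp U u n : wdeg_le U u -> wdeg_le (U ^+ n) (n * u).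
Proof.
move=> Uu; elim: n => [|n IHn]; last by rewrite exprS mulSn; apply: wdeg_leM.
move=> i j; rewrite expr0 mul0n coef1; case: j => [|j] /= w0; last by rewrite coef0.
by rewrite coef1; case: i w0 => //; rewrite !muln0.
Qed.

Lemma wdeg_le_sum I (r : seq I) (P : pred I) (F : I -> {poly {poly K}}) w :
  (forall i, P i -> wdeg_le (F i) w) -> wdeg_le (\sum_(i <- r | P i) F i) w.
Proof.
move=> Fw; elim/big_ind: _ => //; first by move=> i j _; rewrite !coef0.
by move=> U V; apply: wdeg_leD.
Qed.

Lemma wdeg_le_polyC (g : {poly K}) w : (p * (size g).-1 <= w)%N -> wdeg_le g%:P w.
Proof.
move=> gw i j; rewrite coefC; case: eqP => [->|_] wij; last by rewrite coef0.
apply: nth_default; rewrite leqNgt; apply: contraL wij => ig; rewrite -leqNgt muln0 addn0.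
by rewrite (leq_trans _ gw) // leq_mul2l -ltnS (leq_trans ig) ?leqSpred ?orbT.
Qed.

Lemma wdeg_leX : wdeg_le 'X d.
Proof.
move=> i j; rewrite coefX; case: eqP => [->|_] dj; last by rewrite coef0.
by rewrite coef1; case: i dj => //; rewrite muln0 muln1 ltnn.
Qed.

Variable sigma : K.

(** Replacing [x] by [X^p] and [y] by [sigma X^d] turns weighted degree into ordinary degree. When
    [sigma ^+ p] is the leading coefficient of [f], this mimics the behaviour of [x] and [y] at
    infinity on [y^p = y + f x]. *)
Definition wsubst (W : {poly {poly K}}) : {poly K} :=
  (map_poly (comp_poly 'X^p) W).[sigma *: 'X^d].

HB.instance Definition _ := GRing.RMorphism.copy wsubst
  (horner_eval (sigma *: 'X^d) \o map_poly (comp_poly ('X^p : {poly K}))).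

Lemma wsubstC (g : {poly K}) : wsubst g%:P = g \Po 'X^p.
Proof. by rewrite /wsubst map_polyC hornerC. Qed.

Lemma wsubstX : wsubst 'X = sigma *: 'X^d.
Proof. by rewrite /wsubst map_polyX hornerX. Qed.

Lemma size_wsubst W w : wdeg_le W w -> (size (wsubst W) <= w.+1)%N.
Proof.
move=> Ww; rewrite -[W]coefK poly_def rmorph_sum /=.
apply: (leq_trans (size_sum _ _ _)); apply/bigmax_leqP => j _.
rewrite -mul_polyC rmorphM rmorphXn /= wsubstC wsubstX.
rewrite -[W`_j]coefK poly_def rmorph_sum mulr_suml /=.
apply: (leq_trans (size_sum _ _ _)); apply/bigmax_leqP => i _.
have [->|Wij] := eqVneq W`_j`_i 0; first by rewrite scale0r linear0 mul0r size_poly0.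
rewrite linearZ /= comp_Xn_poly -!exprM exprZn -exprM -scalerAl -scalerAr scalerA -exprD.
rewrite (leq_trans (size_scale_leq _ _)) // size_polyXn ltnS leqNgt.
by apply: contra Wij => wlt; rewrite Ww.
Qed.

(* The leading form, of weight [w], evaluated at [x = 1], [y = sigma]. *)
Definition wlead W w : K := (wsubst W)`_w.

Lemma wleadM U V u v : wdeg_le U u -> wdeg_le V v ->
  wlead (U * V) (u + v) = wlead U u * wlead V v.
Proof. by move=> Uu Vv; rewrite /wlead rmorphM coefM_top ?size_wsubst. Qed.

Lemma wlead_exp U u n : wdeg_le U u -> wlead (U ^+ n) (n * u) = wlead U u ^+ n.
Proof.
move=> Uu; elim: n => [|n IHn]; first by rewrite mul0n !expr0 /wlead rmorph1 coef1.
by rewrite !exprS mulSn wleadM ?IHn //; apply: wdeg_le_exp.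
Qed.

Lemma wleadD U V w : wlead (U + V) w = wlead U w + wlead V w.
Proof. by rewrite /wlead rmorphD coefD. Qed.

Lemma wleadN U w : wlead (- U) w = - wlead U w.
Proof. by rewrite /wlead rmorphN coefN. Qed.

Lemma wlead_sum I (r : seq I) (P : pred I) (F : I -> {poly {poly K}}) w :
  wlead (\sum_(i <- r | P i) F i) w = \sum_(i <- r | P i) wlead (F i) w.
Proof. by rewrite /wlead rmorph_sum coef_sum. Qed.

Lemma wlead_lt W w w' : wdeg_le W w -> (w < w')%N -> wlead W w' = 0.
Proof. by move=> Ww ww'; apply/nth_default/(leq_trans (size_wsubst Ww)). Qed.

Lemma wlead0 w : wlead 0 w = 0.
Proof. by rewrite /wlead rmorph0 coef0. Qed.

Lemma wleadX : wlead 'X d = sigma.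
Proof. by rewrite /wlead wsubstX coefZ coefXn eqxx mulr1. Qed.

Definition eval2 (x y : K) (W : {poly {poly K}}) : K := W.[y%:P].[x].

HB.instance Definition _ x y := GRing.RMorphism.copy (eval2 x y)
  (horner_eval x \o horner_eval y%:P).

Lemma eval2C x y (g : {poly K}) : eval2 x y g%:P = g.[x].
Proof. by rewrite /eval2 hornerC. Qed.

Lemma eval2X x y : eval2 x y 'X = y.
Proof. by rewrite /eval2 hornerX hornerC. Qed.

Hypotheses (p_gt1 : (1 < p)%N) (d_gt0 : (0 < d)%N).

Lemma wlead_polyC (g : {poly K}) i : wlead g%:P (p * i) = g`_i.
Proof.
rewrite /wlead wsubstC -[in LHS](coefK g) poly_def rmorph_sum coef_sum /=.
under eq_bigr => k _.
  rewrite linearZ /= comp_Xn_poly -exprM coefZ coefXn eqn_pmul2l ?(ltnW p_gt1) //.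
  over.
have [ig|gi] := ltnP i (size g).
  rewrite (bigD1 (Ordinal ig)) //= eqxx mulr1 big1 ?addr0 // => k ki.
  suff /negbTE-> : i != k by rewrite mulr0.
  by apply: contra ki => /eqP ik; apply/eqP/val_inj.
rewrite nth_default // big1 // => k _; rewrite (@gtn_eqF k i) ?mulr0 //.
exact: leq_trans (ltn_ord k) gi.
Qed.

Variable f : {poly K}.
Hypotheses (szf : size f = d.+1) (sigmaE : sigma ^+ p = lead_coef f).

(* Replacing [y^p] by [y + f x] preserves leading forms, as [sigma^p] is the
   leading coefficient of [f]. *)
Lemma artin_schreier_reduce W w : wdeg_le W w ->
  exists V : {poly {poly K}}, [/\ (size V <= p)%N, wdeg_le V w, wlead V w = wlead W w &
    forall x y, y ^+ p = y + f.[x] -> eval2 x y V = eval2 x y W].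
Proof.
have [n] := ubnP (size W); elim: n W => // n IHn W szW Ww.
have [Wp|pW] := leqP (size W) p; first by exists W; split.
have szWE: (size W).-1.+1 = size W by rewrite prednK // (leq_trans _ pW).
set m := (size W).-1 in szWE; have pm: (p <= m)%N by rewrite -ltnS szWE.
pose c := W`_m; pose E : {poly {poly K}} := 'X^p - 'X - f%:P.
have Edeg: wdeg_le E (p * d).
  apply: wdeg_leD; last by apply/wdeg_leN/wdeg_le_polyC; rewrite szf.
  apply: wdeg_leD; first by apply/wdeg_le_exp/wdeg_leX.
  by apply: wdeg_leN; apply: wdeg_le_trans wdeg_leX _; rewrite leq_pmull // ltnW.
(* In weight [p * d] the equation [E] of the curve contributes [sigma ^+ p - lead_coef f = 0], so
   subtracting its multiples preserves the leading form. *)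
have Elead: wlead E (p * d) = 0.
  rewrite !wleadD !wleadN wlead_polyC wlead_exp ?wleadX; last exact: wdeg_leX.
  rewrite (wlead_lt wdeg_leX) ?subr0; last by rewrite ltn_Pmull.
  by rewrite sigmaE lead_coefE szf subrr.
have c_neq0: c != 0 by rewrite -[c]lead_coefE lead_coef_eq0 -size_poly_gt0 -szWE.
(* The nonzero coefficient of [y^m], with [m >= p], has a monomial of weight at least [d * m]. Hence
   [w - p * d] is not truncated. *)
have pdw: (p * d <= w)%N.
  rewrite leqNgt; apply/negP => wpd; case/negP: c_neq0; apply/eqP/polyP => i.
  rewrite coef0 Ww // (leq_trans wpd) // mulnC addnC.
  by rewrite (leq_trans _ (leq_addr _ _)) // leq_mul2l pm orbT.
have cdeg: wdeg_le (c%:P * 'X^(m - p)) (w - p * d).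
  move=> i j wij; rewrite coefCM coefXn.
  case: eqP wij => [->|_] wij; last by rewrite mulr0 coef0.
  rewrite mulr1 Ww //; move: wij; rewrite mulnBr.
  have : (p * d <= d * m)%N by rewrite mulnC leq_mul2l pm orbT.
  by rewrite (mulnC d p); lia.
have [||V [szV Vw Vlead Veval]] := IHn (W - c%:P * 'X^(m - p) * E).
- rewrite ltnS in szW; apply: leq_trans szW; rewrite -szWE ltnS.
  apply/leq_sizeP => j mj; rewrite coefB -mulrA coefCM coefXnM ltnNge.
  rewrite (leq_trans (leq_subr _ _) mj) /= !coefB coefXn coefX coefC.
  have [->|jm] := eqVneq j m.
    by rewrite subKn // eqxx !gtn_eqF ?subr0 ?mulr1 ?subrr // ltnW.
  have {}jm: (m < j)%N by rewrite ltn_neqAle eq_sym jm.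
  rewrite nth_default; last by rewrite -szWE.
  rewrite !gtn_eqF ?subr0 ?mulr0 ?subr0 //; lia.
- apply: wdeg_leD => //; apply: wdeg_leN; rewrite -(subnK pdw).
  exact: wdeg_leM.
exists V; split=> // [|x y yE].
  by rewrite Vlead wleadD wleadN -[X in wlead (_ * E) X](subnK pdw) wleadM // Elead mulr0 subr0.
rewrite (Veval _ _ yE) rmorphB rmorphM /= [X in _ * X](_ : _ = 0) ?mulr0 ?subr0 //.
by rewrite !rmorphB rmorphXn /= eval2X eval2C yE; ring.
Qed.

End WeightedDegree.

(** * Stepanov's method *)

Lemma linear_dependency (K : fieldType) (I J : finType) (A : I -> J -> K) :
  (#|J| < #|I|)%N ->
  exists gam : I -> K, (exists e, gam e != 0) /\
    forall j, \sum_e gam e * A e j = 0.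
Proof.
move=> JI; pose M := \matrix_(e < #|I|, j < #|J|) A (enum_val e) (enum_val j).
have: kermx M != 0.
  rewrite kermx_eq0 -row_leq_rank -ltnNge.
  exact: leq_ltn_trans (rank_leq_col M) JI.
case/rowV0Pn => v /sub_kermxP vM v_neq0.
exists (fun e => v 0 (enum_rank e)); split.
  case/rV0Pn: v_neq0 => k vk; exists (enum_val k); by rewrite enum_valK.
move=> j; have := congr1 (fun u : 'rV_ _ => u 0 (enum_rank j)) vM.
rewrite !mxE => vM0; rewrite -[RHS]vM0.
rewrite [RHS](reindex (@enum_rank I)) /=; last exact/onW_bij/enum_rank_bij.
apply: eq_bigr => e _.
by rewrite !mxE !enum_rankK.
Qed.

(** Monomials of degree below [p] in [y] are told apart by their weights, so leading forms of
    different weights cannot cancel. *)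
Lemma weight_inj p d a b a' b' : coprime p d -> (b < p)%N -> (b' < p)%N ->
  (p * a + d * b = p * a' + d * b')%N -> a = a' /\ b = b'.
Proof.
move=> cpd.
wlog bb' : a a' b b' / (b <= b')%N => [hw|bp b'p E].
  by case/orP: (leq_total b b') => bb' bp b'p E; [|case: (hw a' a b' b)]; try apply: hw.
have p_gt0 : (0 < p)%N by apply: leq_ltn_trans bp.
have: (p %| d * (b' - b))%N.
  rewrite mulnBr; have -> : (d * b' - d * b = p * a - p * a')%N by lia.
  by rewrite -mulnBr dvdn_mulr.
rewrite Gauss_dvdr // => pb; have bE: b = b'.
  apply/eqP; rewrite eqn_leq bb' /= -subn_eq0; apply: contraLR pb; rewrite -lt0n => lt0.
  by rewrite gtnNdvd //; lia.
split=> //; move: E; rewrite bE => /addIn /eqP; rewrite eqn_pmul2l // => /eqP; exact.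
Qed.

Section Stepanov.

Variables (K : closedFieldType) (p : nat) (charKp : p \in [pchar K]).
Variables (f : {poly K}) (d m : nat).
Hypotheses (szf : size f = d.+1) (d_gt0 : (0 < d)%N) (dp : (d < p)%N).

Let L := (p ^ m)%N.
Let P := (p ^ m.+1)%N.
Let h : {poly K} := \sum_(i < m.+1) f ^+ (p ^ i).

Let p_pr : prime p. Proof. exact: pcharf_prime charKp. Qed.
Let p_gt1 : (1 < p)%N. Proof. exact: prime_gt1. Qed.
Let p_gt0 : (0 < p)%N. Proof. exact: prime_gt0. Qed.
Let PE : P = (p * L)%N. Proof. exact: expnS. Qed.
Let L_gt0 : (0 < L)%N. Proof. by rewrite expn_gt0 p_gt0. Qed.
Let f_neq0 : f != 0. Proof. by rewrite -size_poly_gt0 szf. Qed.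

Let size_fX i : size (f ^+ i) = (d * i).+1.
Proof.
by rewrite -(prednK (_ : 0 < size (f ^+ i))%N) ?size_exp ?szf // size_poly_gt0 expf_neq0.
Qed.

Let hdeg : wdeg_le p d ('X + h%:P) (d * P).
Proof.
apply: wdeg_leD.
  by apply: wdeg_le_trans (@wdeg_leX K p d) _; rewrite leq_pmulr // PE muln_gt0 p_gt0.
apply: wdeg_le_polyC; rewrite PE mulnCA leq_mul2l; apply/orP; right.
rewrite -subn1 leq_subLR add1n; apply: (leq_trans (size_sum _ _ _)).
by apply/bigmax_leqP => i _; rewrite size_fX ltnS leq_mul2l leq_exp2l // -ltnS ltn_ord orbT.
Qed.

(** Only the last summand [f ^+ (p ^ m)] of [h] reaches the weight [d * P]. *)
Let hlead sigma : wlead p d sigma ('X + h%:P) (d * P) != 0.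
Proof.
rewrite wleadD (wlead_lt _ (@wdeg_leX K p d)); last first.
  by rewrite -[X in (X < _)%N]muln1 ltn_pmul2l // (leq_trans p_gt1) // PE leq_pmulr.
rewrite add0r PE mulnCA wlead_polyC // /h big_ord_recr coefD coef_sum big1 => [|i _] /=.
  have := lead_coef_exp f L; rewrite lead_coefE size_fX /= add0r => ->.
  by rewrite expf_neq0 ?lead_coef_eq0.
by rewrite nth_default // size_fX ltn_pmul2l // ltn_exp2l.
Qed.

(** An auxiliary polynomial with nonzero leading form vanishes at every point of the curve above
    [xs]. After reduction to degree below [p] in [y], each of its coefficients vanishes on [xs], so
    [p * size xs] is at most its weight. *)
Lemma stepanov_bound (xs : seq K) :
  ((p * d + 2) * d < L)%N -> uniq xs ->
  {in xs, forall x, x ^+ (p ^ (m.+1 + m.+1)) = x /\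
                    abs_trace p (m.+1 + m.+1) f.[x] = 0} ->
  (p * size xs <= P * P + (2 * p * d + 1) * P)%N.
Proof.
move=> Lbig uxs xsP.
have [sigma sigmaE] := closed_exprX_root (lead_coef f) p_gt0.
(* With [nA = L - d] the weight of [x^a' y^b'] stays below [P]. All [T e] have weight below
   [p * nC], and [nB = L + d] makes the indices [e] outnumber the [p * nC] reduced monomials once
   [(p - 1) * L > (p * d + 2) * d]. *)
pose nA := (L - d)%N; pose nB := (L + d)%N; pose nC := (P * (L - 1) + nB + d)%N.
(* With [y^P = y + h x] and [x^(P^2) = x], the [P]-th power of the monomial [G e] equals
   [T e] at the points considered; [wt e] is the weighted degree of [G e], and the [T e]
   are more numerous than the monomials that can occur in their reductions. *)
pose I : finType := ('I_nA * 'I_p * 'I_nB * 'I_p)%type.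
pose wt (e : I) := let: (a', b', a, b) := e in
  (p * a' + d * b' + P * (p * a + d * b))%N.
pose T (e : I) : {poly {poly K}} := let: (a', b', a, b) := e in
  ('X^(a' * P + a))%:P * ('X + h%:P) ^+ b' * 'X^b.
pose G (e : I) : {poly {poly K}} := let: (a', b', a, b) := e in
  ('X^(a' + P * a))%:P * 'X^b' * ('X + h%:P) ^+ b.
have wt_small (a' : 'I_nA) (b' : 'I_p) : (p * a' + d * b' + d + p <= P)%N.
  rewrite PE; have -> : L = (nA + d)%N by rewrite /nA; lia.
  rewrite mulnDr; have := ltn_ord a'; have := ltn_ord b'.
  have: (d * b'.+1 <= d * p)%N by rewrite leq_mul2l ltn_ord orbT.
  have: (p * a'.+1 <= p * nA)%N by rewrite leq_mul2l ltn_ord orbT.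
  by rewrite !mulnS (mulnC d p); lia.
have wt_large (a : 'I_nB) (b : 'I_p) : (p * a + d * b < p * (nB + d))%N.
  have: (d * b.+1 <= d * p)%N by rewrite leq_mul2l ltn_ord orbT.
  have: (p * a.+1 <= p * nB)%N by rewrite leq_mul2l ltn_ord orbT.
  by rewrite mulnDr !mulnS (mulnC d p); lia.
(* The two digits of [wt e] in base [P] are the weights of [(a', b')] and [(a, b)], each of which
   determines its pair. *)
have wt_inj : injective wt.
  case=> [[[a1 b1] a2] b2] [[[a1' b1'] a2'] b2'] /= wtE.
  have P_gt0 : (0 < P)%N by rewrite PE muln_gt0 p_gt0.
  have lt1 (a : 'I_nA) (b : 'I_p) : (p * a + d * b < P)%N.
    by have := wt_small a b; lia.
  have cpd : coprime p d by rewrite prime_coprime // gtnNdvd.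
  have := congr1 (modn^~ P) wtE; rewrite !(addnC _ (P * _)%N) !(mulnC P) !modnMDl !modn_small //.
  have := congr1 (divn^~ P) wtE.
  rewrite !(addnC _ (P * _)%N) !(mulnC P) !divnMDl // !divn_small // !addn0.
  case/weight_inj => // /val_inj -> /val_inj ->.
  by case/weight_inj => // /val_inj -> /val_inj ->.
have T_deg e : wdeg_le p d (T e) (p * nC).-1.
  case: e => [[[a' b'] a] b] /=.
  have Tdeg: wdeg_le p d (('X^(a' * P + a))%:P * ('X + h%:P) ^+ b' * 'X^b)
      (p * (a' * P + a) + b' * (d * P) + b * d).
    apply: wdeg_leM; last exact/wdeg_le_exp/wdeg_leX.
    by apply: wdeg_leM; [apply: wdeg_le_polyC; rewrite size_polyXn | apply: wdeg_le_exp].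
  apply: wdeg_le_trans Tdeg _; rewrite -ltnS prednK; last first.
    by rewrite muln_gt0 p_gt0 !addn_gt0 d_gt0 !orbT.
  have nCE : (p * nC = (P - p) * P + p * (nB + d))%N.
    rewrite /nC -addnA mulnDr; congr (_ + _)%N.
    by rewrite mulnCA mulnBr muln1 -PE mulnC.
  have lt2 := wt_large a b; rewrite nCE.
  have: ((p * a' + d * b') * P <= (P - p) * P)%N.
    by rewrite leq_mul2r; have := wt_small a' b'; lia.
  by move: lt2; rewrite !mulnDr !mulnDl (mulnC b d) (mulnC b') (mulnAC d P) mulnA; lia.
have /fin_all_exists [R RP] (e : I) : exists V : {poly {poly K}},
    [/\ (size V <= p)%N, wdeg_le p d V (p * nC).-1 &
      forall x y, y ^+ p = y + f.[x] -> eval2 x y V = eval2 x y (T e)].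
  have [V [? ? _ ?]] := artin_schreier_reduce p_gt1 d_gt0 szf sigmaE (T_deg e).
  by exists V.
have card_lt : (nC < p * (nA * nB))%N.
  have LE : L = (nA + d)%N by rewrite /nA; lia.
  have: (2 * L <= p * L)%N by rewrite leq_mul2r p_gt1 orbT.
  rewrite /nC /nB PE LE mulnBr muln1; move: Lbig; rewrite LE.
  have: (p * (nA + d) <= p * (nA + d) * (nA + d))%N by rewrite leq_pmulr // -LE.
  by move: p_gt1; clearbody L; clear; lia.
have [|gam [[e0 gam_e0] gamP]] := @linear_dependency K I ('I_p * 'I_nC)%type
    (fun e k => (R e)`_(k.1)`_(k.2)).
  rewrite !card_prod !card_ord mulnC ltn_pmul2r //.
  by rewrite mulnAC mulnC.
have gamR : \sum_e (gam e)%:P *: R e = 0.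
  apply/polyP => j; apply/polyP => i; rewrite !coef0 !coef_sum.
  under eq_bigr => e _ do rewrite coefZ coefCM.
  have [jp|pj] := ltnP j p; last first.
    apply: big1 => e _; have [szR _ _] := RP e.
    by rewrite (nth_default _ (leq_trans szR pj)) coef0 mulr0.
  have [iC|Ci] := ltnP i nC; first exact: (gamP (Ordinal jp, Ordinal iC)).
  apply: big1 => e _; have [_ Rdeg _] := RP e; rewrite Rdeg ?mulr0 //.
  rewrite prednK; last by rewrite muln_gt0 p_gt0 !addn_gt0 d_gt0 !orbT.
  by rewrite (leq_trans _ (leq_addr _ _)) // leq_mul2l Ci orbT.
(* Coefficients are replaced by their [P]-th roots because it is the [P]-th power of [GG] that
   becomes the relation among the [T e]. *)
have /fin_all_exists [c cP] (e : I) : exists a : K, a ^+ P = gam e.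
  by apply: closed_exprX_root; rewrite PE muln_gt0 p_gt0.
have c_neq0 e : (c e != 0) = (gam e != 0).
  by rewrite -cP expf_eq0 PE muln_gt0 p_gt0 L_gt0.
pose GG := \sum_e (c e)%:P *: G e.
(* The vanishing trace gives [y ^+ (P * P) = y], that is, [(y + h x) ^+ P = y]. Together with
   [x ^+ (P * P) = x] this sends each [G e] to [T e]. *)
have GG0 x y : x \in xs -> y ^+ p = y + f.[x] -> eval2 x y GG = 0.
  move=> /xsP[xQ trx] yE; have PP : (p ^ (m.+1 + m.+1) = P * P)%N by rewrite expnD.
  have yP : y ^+ P = y + h.[x].
    rewrite (artin_schreier_iter charKp _ yE) /abs_trace horner_sum.
    by congr (_ + _); apply: eq_bigr => i _; rewrite horner_exp.
  have yPP : (y + h.[x]) ^+ P = y.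
    by rewrite -yP -exprM -PP (artin_schreier_iter charKp _ yE) trx addr0.
  apply/eqP; suff: eval2 x y GG ^+ P == 0 by rewrite expf_eq0 => /andP[].
  rewrite rmorph_sum expr_sum_pchar //=.
  have := congr1 (eval2 x y) gamR; rewrite rmorph_sum rmorph0 /= => gamR0.
  apply/eqP; rewrite -[RHS]gamR0; apply: eq_bigr => e _.
  rewrite -!mul_polyC !rmorphM /= !eval2C !hornerC exprMn cP; congr (_ * _).
  have [_ _ ->] := RP e; last by [].
  case: e => [[[a' b'] a] b] /=.
  rewrite !rmorphM !rmorphXn !rmorphD /= !eval2C !eval2X !hornerX.
  rewrite !exprMn -!exprM ![(_ * P)%N]mulnC !exprM yPP yP -!exprM; congr (_ * _ * _).
  by rewrite mulnDr mulnA -PP exprD [X in _ * X]exprM xQ -exprD [(P * _)%N]mulnC.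
have G_deg e : wdeg_le p d (G e) (wt e).
  case: e => [[[a' b'] a] b] /=.
  have -> : (p * a' + d * b' + P * (p * a + d * b) =
             p * (a' + P * a) + b' * d + b * (d * P))%N.
    by rewrite !mulnDr (mulnC b') !addnA; lia.
  apply: wdeg_leM; last exact: wdeg_le_exp.
  apply: wdeg_leM; last exact/wdeg_le_exp/wdeg_leX.
  by apply: wdeg_le_polyC; rewrite size_polyXn.
have G_lead e : wlead p d sigma (G e) (wt e) != 0.
  case: e => [[[a' b'] a] b] /=.
  have -> : (p * a' + d * b' + P * (p * a + d * b) =
             p * (a' + P * a) + b' * d + b * (d * P))%N.
    by rewrite !mulnDr (mulnC b') !addnA; lia.
  have XC_deg : @wdeg_le K p d ('X^(a' + P * a))%:P (p * (a' + P * a)).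
    by apply: wdeg_le_polyC; rewrite size_polyXn.
  have Xb_deg := wdeg_le_exp (n := b') (@wdeg_leX K p d).
  rewrite wleadM; [|exact: wdeg_leM|exact: wdeg_le_exp].
  rewrite wleadM // wlead_polyC // coefXn eqxx mul1r wlead_exp ?wleadX; last exact: wdeg_leX.
  rewrite wlead_exp // mulf_neq0 ?expf_neq0 //.
  by apply: contraNneq f_neq0 => sigma0; rewrite -lead_coef_eq0 -sigmaE sigma0 expr0n gtn_eqF.
(* Weights being distinct, the heaviest term present is alone in its weight, so it survives in the
   leading form of [GG]. *)
case: (@arg_maxnP I e0 (fun e => gam e != 0) wt gam_e0) => em gam_em em_max.
pose w := wt em.
have GG_deg : wdeg_le p d GG w.
  apply: wdeg_le_sum => e _; have [c0|ce] := eqVneq (c e) 0.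
    by move=> i j _; rewrite c0 scale0r !coef0.
  have Ge : wdeg_le p d (G e) w.
    by apply: wdeg_le_trans (G_deg e) _; apply: em_max; rewrite /= -c_neq0.
  rewrite -mul_polyC -[w]add0n; apply: wdeg_leM => //.
  by apply: wdeg_le_polyC; rewrite size_polyC; case: (c e != 0); rewrite muln0.
have wlead_cG e u : wlead p d sigma ((c e)%:P *: G e) u = c e * wlead p d sigma (G e) u.
  by rewrite -mul_polyC /wlead rmorphM /= wsubstC comp_polyC coefCM.
have GG_lead : wlead p d sigma GG w != 0.
  rewrite wlead_sum (bigD1 em) //= big1 ?addr0 => [|e e_em]; rewrite wlead_cG.
    by rewrite mulf_neq0 ?c_neq0 // G_lead.
  have [->|ce] := eqVneq (c e) 0; first by rewrite mul0r.
  rewrite (wlead_lt _ (G_deg e)) ?mulr0 // ltn_neqAle (inj_eq wt_inj) e_em.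
  by apply: em_max; rewrite /= -c_neq0.
have [V [szV V_deg V_lead V_eval]] := artin_schreier_reduce p_gt1 d_gt0 szf sigmaE GG_deg.
have [j Vj] : exists j, V`_j != 0.
  exists (size V).-1; rewrite -lead_coefE lead_coef_eq0.
  by apply: contraNneq GG_lead => V0; rewrite -V_lead V0 wlead0.
(* Above [x] there are [p] distinct values of [y], all roots of the specialisation of [V] at [x],
   whose degree is below [p]; hence it is zero. *)
have Vj_root x : x \in xs -> root V`_j x.
  move=> xxs; have [ys [uys szys ysP]] := artin_schreier_rootsP charKp f.[x] (ltn0Sn 0).
  have: map_poly (horner_eval x) V = 0.
    apply/eqP; apply: contraT => Vx_neq0.
    have /(max_poly_roots Vx_neq0) : all (root (map_poly (horner_eval x) V)) ys.
      apply/allP => y; rewrite ysP expn1 => /eqP yE.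
      have := V_eval _ _ yE; rewrite GG0 //.
      rewrite rootE -[X in _.[X]](hornerC y x) -/(horner_eval x y%:P) horner_map.
      by move=> V0; apply/eqP.
    move=> /(_ uys); rewrite szys expn1 ltnNge (leq_trans _ szV) //.
    exact: size_poly.
  by move/(congr1 (fun q : {poly K} => q`_j)); rewrite coef_map coef0 rootE => /eqP.
have sz_xs : (size xs < size (V`_j)%R)%N by apply: max_poly_roots => //; apply/allP.
have wlt : (w < P + P * (p * (nB + d)))%N.
  rewrite /w; case: (em) => [[[a' b'] a] b] /=.
  have lt1 := wt_small a' b'; have /ltnW := wt_large a b.
  by rewrite -(leq_pmul2l (_ : 0 < P)%N) ?PE ?muln_gt0 ?p_gt0 // => ?; lia.
have : (p * (size (V`_j)%R).-1 + d * j <= w)%N.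
  by rewrite leqNgt; apply: contra Vj => wV; rewrite -lead_coef_eq0 lead_coefE V_deg.
have: (p * size xs <= p * (size (V`_j)%R).-1)%N by rewrite leq_mul2l; lia.
move: wlt; rewrite /nB PE.
lia.
Qed.

End Stepanov.

(** * Additive characters *)

Section AdditiveCharacter.

Variables (K : closedFieldType) (p : nat) (charKp : p \in [pchar K]).
Variables (zeta : algC) (zetaP : p.-primitive_root zeta).

Let p_gt0 : (0 < p)%N. Proof. exact/prime_gt0/(pcharf_prime charKp). Qed.

(* The character [a |-> zeta^a] of the prime field of [K]; the value outside of
   the prime field is the junk value [0]. *)
Definition psi (x : K) : algC := \sum_(c < p) (x == c%:R)%:R * zeta ^+ c.

Lemma psi_nat a : psi a%:R = zeta ^+ a.
Proof.
rewrite /psi (bigD1 (Ordinal (ltn_pmod a p_gt0))) //= (natr_eq_pchar charKp) modn_mod eqxx mul1r.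
rewrite (prim_expr_mod zetaP) big1 ?addr0 // => c ca; rewrite (natr_eq_pchar charKp).
rewrite (modn_small (ltn_ord c)); case: eqP => [ac|]; last by rewrite mul0r.
by case/eqP: ca; apply/val_inj.
Qed.

Lemma psi0 : psi 0 = 1.
Proof. by rewrite -[0]/(0%:R) psi_nat. Qed.

(** The [p] residues already exhaust the [p] roots of [X^p - X]. *)
Lemma prime_subfieldP (x : K) : reflect (exists a : 'I_p, x = a%:R) (x ^+ p == x).
Proof.
apply: (iffP idP) => [xp|[b ->]]; last by rewrite -[X in _ ^+ X]expn1 expr_nat_pchar.
have [s [us szs sP]] := artin_schreier_rootsP charKp (0 : K) (ltn0Sn 0).
pose s' := [seq (val a)%:R : K | a <- enum 'I_p].
have us' : uniq s'.
  rewrite map_inj_uniq ?enum_uniq // => a b /eqP.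
  rewrite (natr_eq_pchar charKp) !modn_small ?ltn_ord //.
  by move/eqP/val_inj.
have s's : {subset s' <= s}.
  by move=> y /mapP[c _ ->]; rewrite sP addr0 expr_nat_pchar.
have ss' : s' =i s.
  have [|_ ss'] := uniq_min_size us' s's; last exact: ss'.
  by rewrite szs expn1 size_map size_enum_ord.
have : x \in s by rewrite sP addr0 expn1.
by rewrite -ss' => /mapP[a _ ->]; exists a.
Qed.

Lemma psiD x y : x ^+ p = x -> y ^+ p = y -> psi (x + y) = psi x * psi y.
Proof.
by move=> /eqP/prime_subfieldP[a ->] /eqP/prime_subfieldP[b ->];
  rewrite -natrD !psi_nat exprD.
Qed.

(** For [n > 0], this lists the subfield of [K] with [p ^ n] elements. *)
Definition frob_fixed n : seq K := proots (artin_schreier_poly p n (0 : K)).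

Lemma frob_fixed_uniq n : (0 < n)%N -> uniq (frob_fixed n).
Proof. exact: artin_schreier_roots_uniq. Qed.

Lemma mem_frob_fixed n x : (0 < n)%N -> (x \in frob_fixed n) = (x ^+ (p ^ n) == x).
Proof.
move=> n_gt0; have [_ mon] := artin_schreier_poly_monic charKp (0 : K) n_gt0.
by rewrite mem_proots // artin_schreier_root addr0.
Qed.

Lemma size_frob_fixed n : (0 < n)%N -> size (frob_fixed n) = (p ^ n)%N.
Proof.
move=> n_gt0; have [sz mon] := artin_schreier_poly_monic charKp (0 : K) n_gt0.
by apply/eqP; rewrite -eqSS -size_proots // sz.
Qed.

Definition charsum n (f : {poly K}) : algC :=
  \sum_(x <- frob_fixed n) psi (abs_trace p n f.[x]).

Lemma sum_zeta : (1 < p)%N -> \sum_(c < p) zeta ^+ c = 0.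
Proof.
move=> p_gt1; apply/eqP; have := subrX1 zeta p; rewrite (prim_expr_order zetaP) subrr.
move/esym/eqP; rewrite mulf_eq0 subr_eq0 => /orP[/eqP z1|//].
have := prim_order_dvd zetaP 1; rewrite expr1 z1 eqxx dvdn1 => /eqP p1.
by rewrite p1 in p_gt1.
Qed.

Lemma norm_zeta : `|zeta| = 1.
Proof.
apply/eqP; rewrite -(pexpr_eq1 p_gt0) ?normr_ge0 //.
by rewrite -normrX (prim_expr_order zetaP) normr1.
Qed.

(** Upper bounds on the fibres of the trace suffice: the deficits [U - p * N c] are nonnegative with
    known total, and the constant [U] does not affect the character sum because the powers of [zeta]
    add up to [0]. *)
Lemma stepanov_charsum (f : {poly K}) d m :
  size f = d.+1 -> (0 < d < p)%N -> ((p * d + 2) * d < p ^ m)%N ->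
  (forall x, x ^+ (p ^ (m.+1 + m.+1)) = x ->
             f.[x] ^+ (p ^ (m.+1 + m.+1)) = f.[x]) ->
  `|charsum (m.+1 + m.+1) f| <= ((2 * p * d + 1) * p ^ m.+1)%:R.
Proof.
move=> szf /andP[d_gt0 dp] mbig; set n := (m.+1 + m.+1)%N => fQ.
have n_gt0 : (0 < n)%N by [].
pose N (c : 'I_p) := count (fun x => abs_trace p n f.[x] == c%:R) (frob_fixed n).
have NE (c : 'I_p) : (N c)%:R = \sum_(x <- frob_fixed n) (abs_trace p n f.[x] == c%:R)%:R :> algC.
  by rewrite /N -sum1_count big_mkcond natr_sum; apply: eq_bigr => x _; case: eqP.
set U := (p ^ m.+1 * p ^ m.+1 + (2 * p * d + 1) * p ^ m.+1)%N.
(* Subtracting from [f] a constant of trace [c] turns this fibre into the fibre over [0]. *)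
have N_le c : (p * N c <= U)%N.
  have [a aE] := abs_trace_surj charKp (c%:R : K) n_gt0.
  rewrite /N -size_filter; apply: (stepanov_bound charKp (f := f - a%:P)) mbig _ _ => //.
  - rewrite size_polyDl // size_polyN size_polyC szf.
    by rewrite (leq_ltn_trans (leq_b1 _)).
  - by rewrite filter_uniq ?frob_fixed_uniq.
  move=> x; rewrite mem_filter mem_frob_fixed // => /andP[/eqP trx /eqP xQ]; split=> //.
  by rewrite hornerD hornerN hornerC abs_traceB // aE trx subrr.
have N_sum : (\sum_c N c)%:R = (p ^ n)%:R :> algC.
  rewrite natr_sum; under eq_bigr do rewrite NE.
  rewrite exchange_big /= -size_frob_fixed // -sum1_size natr_sum big_seq [RHS]big_seq.
  apply: eq_bigr => x; rewrite mem_frob_fixed // => /eqP xQ.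
  have: abs_trace p n f.[x] ^+ p == abs_trace p n f.[x].
    by rewrite abs_trace_expr ?fQ.
  case/prime_subfieldP => a ->; rewrite (bigD1 a) //= eqxx big1 ?addr0 // => c ca.
  rewrite (natr_eq_pchar charKp) !modn_small ?ltn_ord //; case: eqP => // ac.
  by case/eqP: ca; apply/val_inj.
have p_neq0 : (p%:R : algC) != 0 by rewrite pnatr_eq0 -lt0n.
rewrite -(ler_pM2l (_ : 0 < p%:R)) ?ltr0n // -{1}(normr_nat _ p) -normrM.
have -> : p%:R * charsum n f = - \sum_(c < p) (U - p * N c)%:R * zeta ^+ c.
  have -> : charsum n f = \sum_(c < p) (N c)%:R * zeta ^+ c.
    rewrite /charsum /psi exchange_big /=; apply: eq_bigr => c _.
    by rewrite -mulr_suml NE.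
  rewrite mulr_sumr -sumrN; under [in RHS]eq_bigr do rewrite natrB // mulrBl opprB natrM.
  rewrite big_split /= sumrN -[X in _ = _ - X]mulr_sumr.
  rewrite sum_zeta ?mulr0 ?subr0 // ?(leq_ltn_trans _ dp) //.
  by apply: eq_bigr => c _; rewrite mulrA.
rewrite normrN; apply: le_trans (ler_norm_sum _ _ _) _.
under eq_bigr => c _.
  rewrite normrM normrX norm_zeta expr1n mulr1 ?normr_nat ?natrB //.
  over.
rewrite sumrB; under [X in _ - X]eq_bigr do rewrite natrM.
rewrite -mulr_sumr -[\sum_i (N i)%:R]natr_sum N_sum -natr_sum sum_nat_const card_ord natrM.
rewrite -mulrBr ler_pM2l ?ltr0n // /U natrD -expnD -/n.
by rewrite addrAC subrr add0r.
Qed.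

End AdditiveCharacter.

(** * Newton identities and power sums *)

Section Newton.

Variable R : comNzRingType.

(** Its coefficient of index [k] is [(-1)^k] times the [k]-th elementary symmetric function of
    [rs]. *)
Definition rev_prod (rs : seq R) : {poly R} := \prod_(r <- rs) (1 - r *: 'X).

Lemma coef_rev_prod_cons r rs k :
  (rev_prod (r :: rs))`_k.+1 = (rev_prod rs)`_k.+1 - r * (rev_prod rs)`_k.
Proof. by rewrite /rev_prod big_cons mulrBl mul1r -scalerAl coefB coefZ coefXM. Qed.

Lemma coef0_rev_prod rs : (rev_prod rs)`_0 = 1.
Proof.
elim: rs => [|r rs IH]; first by rewrite /rev_prod big_nil coef1.
by rewrite /rev_prod big_cons mulrBl mul1r -scalerAl coefB coefZ coefXM mulr0 subr0.
Qed.

Lemma size_rev_prod rs : (size (rev_prod rs) <= (size rs).+1)%N.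
Proof.
elim: rs => [|r rs IH]; first by rewrite /rev_prod big_nil size_poly1.
apply/leq_sizeP => [[|k]] //= rsk; rewrite coef_rev_prod_cons.
by rewrite !(leq_sizeP _ _ IH) ?mulr0 ?subr0 // ltnW.
Qed.

Lemma coef_rev_prodE rs k : (k <= size rs)%N ->
  (rev_prod rs)`_k = (\prod_(r <- rs) ('X - r%:P))`_(size rs - k).
Proof.
elim: rs k => [|r rs IH] [|k] //=.
- by rewrite /rev_prod !big_nil.
- move=> _; rewrite coef0_rev_prod subn0.
  have /monicP := monic_prod_XsubC (r :: rs) xpredT id.
  by rewrite lead_coefE size_prod_XsubC /= => ->.
rewrite ltnS subSS => kn; rewrite coef_rev_prod_cons big_cons mulrBl coefB coefCM coefXM.
rewrite (IH k kn) subn_eq0; congr (_ - _); have [nk|{}kn] := leqP (size rs) k.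
  by rewrite (leq_sizeP _ _ (size_rev_prod _)) // ltnS.
by rewrite IH // -subnS.
Qed.

Lemma newton_identity rs k :
  k%:R * (rev_prod rs)`_k =
  - \sum_(j < k) (\sum_(r <- rs) r ^+ j.+1) * (rev_prod rs)`_(k - j.+1).
Proof.
elim: rs k => [|r rs IH] [|n].
- by rewrite mul0r big_ord0 oppr0.
- rewrite /rev_prod big_nil coef1 mulr0 big1 ?oppr0 // => j _.
  by rewrite big_nil mul0r.
- by rewrite mul0r big_ord0 oppr0.
set E := rev_prod rs in IH *; set E' := rev_prod (r :: rs).
under eq_bigr do rewrite big_cons mulrDl subSS.
rewrite big_split /=.
have -> : \sum_(j < n.+1) r ^+ j.+1 * E'`_(n - j) = r * E`_n.
  elim: n => [|n IHn].
    by rewrite big_ord1 expr1 /E' /E !coef0_rev_prod.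
  rewrite big_ord_recl /= expr1 subn0 /E' coef_rev_prod_cons -/E -/E'.
  under eq_bigr do rewrite /bump /= add1n subSS exprS -mulrA.
  by rewrite -mulr_sumr IHn; ring.
have -> : \sum_(j < n.+1) (\sum_(j0 <- rs) j0 ^+ j.+1) * E'`_(n - j) =
    - (n.+1%:R * E`_n.+1) + r * (n%:R * E`_n).
  rewrite !IH opprK mulrN mulr_sumr.
  rewrite [in LHS]big_ord_recr [X in _ = X - _]big_ord_recr /=.
  rewrite !subnn /E' /E !coef0_rev_prod addrAC; congr (_ + _).
  rewrite -sumrB; apply: eq_bigr => j _; rewrite subSS.
  have -> : (n - j = (n - j.+1).+1)%N by rewrite subnSK.
  by rewrite coef_rev_prod_cons; ring.
rewrite /E' coef_rev_prod_cons -/E -[n.+1]addn1 natrD; ring.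
Qed.

(** The last term of the sum of order [k] is [s k * c 0 = s k], so the recursion yields [s] step by
    step without any division. *)
Lemma log_derivative_unique n (c s t : nat -> R) : c 0%N = 1 ->
  (forall k, (k <= n)%N -> k%:R * c k = - \sum_(j < k) s j.+1 * c (k - j.+1)%N) ->
  (forall k, (k <= n)%N -> k%:R * c k = - \sum_(j < k) t j.+1 * c (k - j.+1)%N) ->
  forall k, (k < n)%N -> s k.+1 = t k.+1.
Proof.
move=> c0 sP tP; elim/ltn_ind => k IH kn.
have := tP k.+1 kn; rewrite sP // => /oppr_inj; rewrite !big_ord_recr /= subnn c0 !mulr1.
under eq_bigr => j _ do rewrite IH ?(ltn_trans _ kn) //.
exact: addrI.
Qed.

(** In Newton's identity of order [n + 1] all terms agree except the coefficient and the power sum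
    of that order. *)
Lemma power_sum_perturb (rs rs' : seq R) n :
  (forall k, (k <= n)%N -> (rev_prod rs)`_k = (rev_prod rs')`_k) ->
  (forall k, (k < n)%N -> \sum_(r <- rs) r ^+ k.+1 = \sum_(r <- rs') r ^+ k.+1) /\
  \sum_(r <- rs) r ^+ n.+1 - \sum_(r <- rs') r ^+ n.+1 =
    - (n.+1%:R * ((rev_prod rs)`_n.+1 - (rev_prod rs')`_n.+1)).
Proof.
move=> EE'.
have pE k : (k < n)%N -> \sum_(r <- rs) r ^+ k.+1 = \sum_(r <- rs') r ^+ k.+1.
  apply: (@log_derivative_unique n (fun k => (rev_prod rs)`_k)
    (fun k => \sum_(r <- rs) r ^+ k) (fun k => \sum_(r <- rs') r ^+ k)).
  - exact: coef0_rev_prod.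
  - by move=> i _; apply: newton_identity.
  move=> i ni; rewrite EE' // newton_identity; congr (- _); apply: eq_bigr => j _.
  by rewrite EE' // (leq_trans (leq_subr _ _)).
split=> //; rewrite mulrBr !newton_identity !big_ord_recr /= !subnn !coef0_rev_prod !mulr1.
have -> : \sum_(j < n) (\sum_(r <- rs) r ^+ j.+1) * (rev_prod rs)`_(n.+1 - j.+1) =
    \sum_(j < n) (\sum_(r <- rs') r ^+ j.+1) * (rev_prod rs')`_(n.+1 - j.+1).
  by apply: eq_bigr => j _; rewrite pE // EE' // subSS leq_subr.
by ring.
Qed.

End Newton.

Section PowerSums.

Variable C : closedFieldType.

(** The generating series of [c] is a polynomial, the product of the [1 - w X]. Newton's identities
    for the [w] are, up to sign, the recursion defining [s]. *)
Lemma power_sum_representation d (c s : nat -> C) : c 0%N = 1 ->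
  (forall k, (d < k)%N -> c k = 0) ->
  (forall k, k%:R * c k = \sum_(j < k) s j.+1 * c (k - j.+1)%N) ->
  exists2 ws : seq C, size ws = d & forall k, s k.+1 = - \sum_(w <- ws) w ^+ k.+1.
Proof.
(* The reversed polynomial is monic of degree exactly [d], even if [c d = 0]; zero is then among the
   [w]. *)
move=> c0 cd sP; pose g := \poly_(i < d.+1) c (d - i)%N.
have szg : size g = d.+1 by rewrite size_poly_eq // subnn c0 oner_eq0.
have mong : g \is monic by rewrite monicE lead_coef_poly // subnn c0 ?oner_eq0.
have szr : size (proots g) = d by apply/eqP; rewrite -eqSS -size_proots // szg.
exists (proots g) => // k.
have cE j : c j = (rev_prod (proots g))`_j.
  have [jd|dj] := leqP j d.
    rewrite coef_rev_prodE ?szr // proots_monic // coef_poly ltnS leq_subr.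
    by rewrite subKn.
  by rewrite cd // (leq_sizeP _ _ (size_rev_prod _)) // szr.
apply: oppr_inj; rewrite opprK.
apply: (@log_derivative_unique _ k.+1 c (fun k => - s k) (fun k => \sum_(w <- _) w ^+ k)) => //
  {}k _.
  by rewrite sP -sumrN; apply: eq_bigr => j _; rewrite mulNr opprK.
by rewrite cE newton_identity; congr (- _); apply: eq_bigr => j _; rewrite cE.
Qed.

End PowerSums.

(** * From the growth of power sums to the size of their terms *)

Section PowerSumGrowth.

Lemma bernoulli_le (R : numDomainType) (x : R) n : 0 <= x -> 1 + n%:R * x <= (1 + x) ^+ n.
Proof.
move=> x_ge0; elim: n => [|n IHn]; first by rewrite mul0r addr0 expr0.
rewrite exprS (le_trans _ (ler_wpM2l _ IHn)) ?addr_ge0 //.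
rewrite -subr_ge0 [X in 0 <= X](_ : _ = n%:R * (x * x)) ?mulr_ge0 //.
by rewrite -[n.+1]addn1 natrD; ring.
Qed.

Lemma bounded_powers (x a : algC) k0 : 0 <= x ->
  (forall k, (k0 <= k)%N -> x ^+ k <= a) -> x <= 1.
Proof.
move=> x_ge0 xa; rewrite real_leNgt ?ger0_real //; apply/negP => x_gt1.
have e_gt0 : 0 < x - 1 by rewrite subr_gt0.
have a_ge0 : 0 <= a by apply: le_trans (xa k0 _) => //; rewrite exprn_ge0.
pose n := (Num.bound (a / (x - 1)) + k0)%N.
have: x ^+ n <= a by rewrite xa // leq_addl.
apply/negP; rewrite -real_ltNge ?ger0_real ?exprn_ge0 //.
rewrite -[x in x ^+ _](subrK 1) addrC.
apply: lt_le_trans (bernoulli_le n (ltW e_gt0)).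
apply: (@lt_trans _ _ (n%:R * (x - 1))); last by rewrite ltrDr.
rewrite -ltr_pdivrMr // natrD.
apply: lt_le_trans (archi_boundP _) _; first by rewrite divr_ge0 // ltW.
by rewrite lerDl ler0n.
Qed.

(** A polynomial [Q] vanishing at every other value in [ws] isolates [w0]: combining shifted power
    sums with the coefficients of [Q] leaves a nonzero constant times [w0 ^+ k], which is thus
    [O(b ^+ k)]. *)
Lemma power_sum_growth (ws : seq algC) (a b : algC) k0 : 0 < b ->
  (forall k, (k0 <= k)%N -> `|\sum_(w <- ws) w ^+ k| <= a * b ^+ k) ->
  {in ws, forall w, `|w| <= b}.
Proof.
move=> b_gt0 wsP w0 w0ws.
pose Q := \prod_(z <- rem w0 (undup ws)) ('X - z%:P).
have Q0 w : w \in ws -> w != w0 -> Q.[w] = 0.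
  move=> wws ww0; apply/rootP; rewrite root_prod_XsubC.
  by rewrite mem_rem_uniq ?undup_uniq // inE ww0 mem_undup.
have Qw0 : Q.[w0] != 0.
  by rewrite -rootE root_prod_XsubC mem_rem_uniq ?undup_uniq // inE eqxx.
pose m := count_mem w0 ws.
have m_gt0 : (0 < m)%N by rewrite -has_count has_pred1.
have QE k : \sum_(i < size Q) Q`_i * (\sum_(w <- ws) w ^+ (k + i)) = m%:R * Q.[w0] * w0 ^+ k.
  under eq_bigr do rewrite mulr_sumr.
  rewrite exchange_big /=.
  transitivity (\sum_(w <- ws | w == w0) Q.[w0] * w0 ^+ k).
    rewrite [RHS]big_mkcond big_seq [RHS]big_seq /=; apply: eq_bigr => w wws.
    have -> : \sum_(i < size Q) Q`_i * w ^+ (k + i) = Q.[w] * w ^+ k.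
      rewrite horner_coef mulr_suml; apply: eq_bigr => i _.
      by rewrite exprD mulrA mulrAC.
    by case: eqVneq => [->|ww0] //; rewrite Q0 // mul0r.
  by rewrite big_const_seq iter_addr addr0 -[in RHS]mulrA mulr_natl.
pose a' := \sum_(i < size Q) `|Q`_i| * a * b ^+ i.
have bound k : (k0 <= k)%N -> `|m%:R * Q.[w0]| * `|w0| ^+ k <= a' * b ^+ k.
  move=> kk; rewrite -normrX -normrM -QE (le_trans (ler_norm_sum _ _ _)) // mulr_suml.
  apply: ler_sum => i _; rewrite normrM -!mulrA ler_wpM2l //.
  by rewrite -exprD [(i + k)%N]addnC wsP // (leq_trans kk) ?leq_addr.
have mQ_gt0 : 0 < `|m%:R * Q.[w0]|.
  by rewrite normr_gt0 mulf_neq0 // pnatr_eq0 -lt0n.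
suff: `|w0| / b <= 1 by rewrite ler_pdivrMr // mul1r.
apply: (@bounded_powers _ (a' / `|m%:R * Q.[w0]|) k0) => [|k /bound].
  by rewrite divr_ge0 // ltW.
by rewrite ler_pdivlMr // expr_div_n mulrAC ler_pdivrMr ?exprn_gt0 // mulrC.
Qed.

End PowerSumGrowth.

(** * Frobenius orbits *)

Section FrobeniusOrbits.

Variables (K : closedFieldType) (p : nat) (charKp : p \in [pchar K]) (r : nat).
Hypothesis r_gt0 : (0 < r)%N.

(* The proof argument only serves to infer the morphism structure. *)
Definition qfrob of p \in [pchar K] := fun x : K => x ^+ (p ^ r).

Local Notation phi := (qfrob charKp).

Fact qfrob_is_zmod_morphism : zmod_morphism phi.
Proof. by move=> x y; apply: exprB_pchar. Qed.

Fact qfrob_is_monoid_morphism : monoid_morphism phi.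
Proof. by split=> [|x y]; rewrite /qfrob ?expr1n ?exprMn. Qed.

HB.instance Definition _ := GRing.isZmodMorphism.Build K K phi qfrob_is_zmod_morphism.
HB.instance Definition _ := GRing.isMonoidMorphism.Build K K phi qfrob_is_monoid_morphism.

Lemma iter_qfrob i x : iter i phi x = x ^+ (p ^ (r * i)).
Proof.
elim: i => [|i IHi]; first by rewrite muln0 expr1.
by rewrite iterS IHi /qfrob -exprM -expnD mulnS addnC.
Qed.

Lemma iter_qfrob_inj i : injective (iter i phi).
Proof. by elim: i => [|i IHi] x y //= /fmorph_inj /IHi. Qed.

Lemma iter_qfrob_cancel i k x : (i <= k)%N -> iter i phi x = iter k phi x -> iter (k - i) phi x = x.
Proof. by move=> ik; rewrite -{1}(subnKC ik) iterD => /iter_qfrob_inj. Qed.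

(** When [iter j phi x = x] and [j > 0], this is a power of the minimal polynomial of [x] over the
    fixed field of [phi]. *)
Definition orbit_poly j x : {poly K} := \prod_(i < j) ('X - (iter i phi x)%:P).

Lemma orbit_poly_monic j x : orbit_poly j x \is monic.
Proof. exact: monic_prod_XsubC. Qed.

Lemma orbit_poly_seq j x :
  orbit_poly j x = \prod_(z <- [seq iter i phi x | i <- iota 0 j]) ('X - z%:P).
Proof.
rewrite big_map /orbit_poly -(big_mkord xpredT (fun i => 'X - (iter i phi x)%:P)).
by rewrite /index_iota subn0.
Qed.

Lemma size_orbit_poly j x : size (orbit_poly j x) = j.+1.
Proof. by rewrite orbit_poly_seq size_prod_XsubC size_map size_iota. Qed.

Lemma orbit_polyD e j x : iter e phi x = x ->
  orbit_poly (e + j) x = orbit_poly e x * orbit_poly j x.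
Proof.
move=> xe; rewrite /orbit_poly big_split_ord /=; congr (_ * _).
by apply: eq_bigr => i _; rewrite addnC iterD xe.
Qed.

Lemma orbit_poly_root j x : (0 < j)%N -> root (orbit_poly j x) x.
Proof.
case: j => // j _; rewrite orbit_poly_seq root_prod_XsubC.
by rewrite inE eqxx.
Qed.

(** Encodes that [g] has coefficients in the field with [p ^ r] elements. *)
Definition qfrob_stable (g : {poly K}) := map_poly phi g == g.

Lemma orbit_poly_stable j x : iter j phi x = x -> qfrob_stable (orbit_poly j x).
Proof.
move=> xj; rewrite /qfrob_stable /orbit_poly rmorph_prod /=.
case: j xj => [|j] xj; first by rewrite !big_ord0.
rewrite [X in _ == X]big_ord_recl [X in X == _]big_ord_recr /=.
rewrite map_polyXsubC -iterS xj mulrC; apply/eqP; congr (_ * _).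
by apply: eq_bigr => i _; rewrite map_polyXsubC.
Qed.

Lemma qfrob_stable_root g x : qfrob_stable g -> root g x -> root g (phi x).
Proof. by move=> /eqP sg gx; rewrite -sg rootE horner_map fmorph_eq0. Qed.

Lemma qfrob_stable_iter g x i : qfrob_stable g -> root g x -> root g (iter i phi x).
Proof. by move=> sg gx; elim: i => //= i; apply: qfrob_stable_root. Qed.

Lemma orbit_period g x : qfrob_stable g -> g \is monic -> root g x ->
  exists e, [/\ (0 < e)%N, (e < size g)%N, iter e phi x = x &
    uniq [seq iter i phi x | i <- iota 0 e]].
Proof.
move=> sg mong gx; pose P e := (0 < e)%N && (iter e phi x == x).
have key n : ~~ uniq [seq iter i phi x | i <- iota 0 n] -> exists2 e, P e & (e < n)%N.
  case/(uniqPn x) => i [k []]; rewrite size_map size_iota => ik kn.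
  rewrite !(nth_map 0%N) ?size_iota ?(ltn_trans ik) // !nth_iota ?(ltn_trans ik) // !add0n.
  move=> /(iter_qfrob_cancel (ltnW ik)) xE; exists (k - i)%N.
    by rewrite /P subn_gt0 ik xE /=.
  by apply: leq_ltn_trans kn; apply: leq_subr.
have exP : exists2 e, P e & (e < size g)%N.
  apply: key; apply/negP => us.
  have /(max_poly_roots (monic_neq0 mong)) : all (root g) [seq iter i phi x | i <- iota 0 (size g)].
    by apply/allP => _ /mapP[i _ ->]; apply: qfrob_stable_iter.
  by move/(_ us); rewrite size_map size_iota ltnn.
have exP' : exists e, P e by case: exP => e; exists e.
case: (ex_minnP exP') => e Pe emin; exists e.
have [e_gt0 /eqP xe] := andP Pe; split=> //.
  by case: exP => e' /emin ee' e's; apply: leq_ltn_trans e's.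
by apply/contraT => /key[e' /emin ee']; rewrite ltnNge ee'.
Qed.

(** If [x] has period [e], only multiples [k * e] of [e] contribute. There [orbit_poly] is the
    [k]-th power of the minimal polynomial, which divides [g] exactly when [k] is at most the
    multiplicity of [x]. *)
Lemma count_orbit_divisors (g : {poly K}) x m :
  qfrob_stable g -> g \is monic -> (size g <= m.+1)%N ->
  (\sum_(j < m) ((iter j.+1 phi x == x) && (orbit_poly j.+1 x %| g)%R) =
    count_mem x (proots g))%N.
Proof.
have [n] := ubnP (size g); elim: n g m => // n IHn g m szg sg mong gm.
have [gx|ngx] := boolP (root g x); last first.
  rewrite (count_memPn _) ?mem_proots // big1 // => j _; apply/eqP; rewrite eqb0.
  apply: contra ngx => /andP[_ /dvdpP[h ->]].
  by rewrite rootM orbit_poly_root ?orbT.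
have [e [e_gt0 esz xe ue]] := orbit_period sg mong gx.
have em : (e <= m)%N by rewrite -ltnS (leq_trans esz).
have [g' gE] : exists g' : {poly K}, g = g' * orbit_poly e x.
  apply/dvdpP; rewrite orbit_poly_seq uniq_roots_dvdp //; last by rewrite uniq_rootsE.
  by apply/allP => _ /mapP[i _ ->]; apply: qfrob_stable_iter.
have We_neq0 := monic_neq0 (orbit_poly_monic e x).
have mong' : g' \is monic by rewrite -(monicMr _ (orbit_poly_monic e x)) -gE.
have sg' : qfrob_stable g'.
  apply/eqP/(mulIf We_neq0); rewrite -gE -(eqP sg) [in RHS]gE rmorphM /=.
  by rewrite (eqP (orbit_poly_stable xe)).
have szg' : size g = (size g' + e)%N.
  by rewrite gE size_Mmonic ?monic_neq0 ?orbit_poly_monic // size_orbit_poly addnS.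
have -> : count_mem x (proots g) = (1 + count_mem x (proots g'))%N.
  have : perm_eq (proots g) ([seq iter i phi x | i <- iota 0 e] ++ proots g').
    by apply: prod_XsubC_eq; rewrite big_cat /= -orbit_poly_seq !proots_monic // mulrC.
  move/permP->; rewrite count_cat count_uniq_mem //; congr (_ + _)%N.
  by case: (e) e_gt0 => // e' _; rewrite inE eqxx.
(* Lengths below [e] contribute nothing, length [e] contributes one, and longer ones count for the
   quotient [g'] after removing one period. *)
have -> : m = (e.-1 + (1 + (m - e)))%N by lia.
rewrite big_split_ord /= big_split_ord /= big_ord1 /=.
rewrite big1 => [|i _]; last first.
  apply/eqP; rewrite eqb0 negb_and; apply/orP; left; apply: contraL ue => /eqP xi.
  apply/(uniqPn x); exists 0%N, i.+1; rewrite size_map size_iota; have := ltn_ord i => ie.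
  have ie' : (i.+1 < e)%N by lia.
  by rewrite !(nth_map 0%N) ?size_iota // !nth_iota // add0n xi.
rewrite add0n addn0 prednK //; congr (_ + _)%N.
  by rewrite -iterS prednK // xe eqxx gE dvdp_mull.
rewrite -(IHn g' (m - e)%N) //; first last.
- by move: szg gm; rewrite szg'; lia.
- by move: szg gm; rewrite szg'; lia.
apply: eq_bigr => j _; rewrite -iterS.
have -> : ((e.-1 + (1 + j)).+1 = e + j.+1)%N by lia.
rewrite [in iter _ _ _]addnC iterD xe orbit_polyD // gE.
by rewrite [g' * _]mulrC dvdp_mul2l.
Qed.

(** The multiplicities of the distinct roots add up to the degree. This is the analogue of the
    logarithm being the divisor sum of the von Mangoldt function. *)
Lemma mem_orbit_divisors (g : {poly K}) m :
  qfrob_stable g -> g \is monic -> size g = m.+1 ->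
  (\sum_(j < m) count (fun x => orbit_poly j.+1 x %| g)%R (frob_fixed K p (r * j.+1)) = m)%N.
Proof.
move=> sg mong szg.
have szr : size (proots g) = m by apply/eqP; rewrite -eqSS -size_proots // szg.
have szE : (\sum_(x <- undup (proots g)) count_mem x (proots g) = m)%N.
  rewrite -[RHS]szr -sum1_size -[RHS]big_undup_iterop_count /=; apply: eq_bigr => x _.
  by elim: (count_mem _ _) => // n IHn; rewrite Monoid.iteropE iterS -Monoid.iteropE /= -IHn.
rewrite -[RHS]szE.
under [RHS]eq_bigr => x _ do rewrite -(count_orbit_divisors x sg mong (eq_leq szg)).
rewrite exchange_big /=; apply: eq_bigr => j _.
rewrite -size_filter -[RHS]big_mkcond sum1_count -size_filter /=.
apply/eqP; rewrite -uniq_size_uniq ?filter_uniq ?undup_uniq ?frob_fixed_uniq // ?muln_gt0 ?r_gt0 //.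
move=> x; rewrite !mem_filter mem_undup mem_proots // mem_frob_fixed ?muln_gt0 ?r_gt0 //.
rewrite -iterS iter_qfrob -andbA andbCA; case: eqP; rewrite ?andbF ?andbT //= => _.
case: (boolP (_ %| g)) => //= /dvdpP[h ->]; rewrite rootM orbit_poly_root ?orbT //.
Qed.

End FrobeniusOrbits.

(** * The L-function *)

Section MonicPolynomials.

Variable F : finFieldType.

Definition monic_of m (u : {ffun 'I_m -> F}) : {poly F} :=
  'X^m + \sum_(i < m) u i *: 'X^i.

Definition low_coefs m (g : {poly F}) : {ffun 'I_m -> F} := [ffun i : 'I_m => g`_i].

Let size_low m (u : {ffun 'I_m -> F}) : (size (\sum_(i < m) u i *: 'X^i)%R <= m)%N.
Proof.
apply: (leq_trans (size_sum _ _ _)); apply/bigmax_leqP => i _.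
by rewrite (leq_trans (size_scale_leq _ _)) // size_polyXn.
Qed.

Lemma size_monic_of m u : size (@monic_of m u) = m.+1.
Proof. by rewrite size_polyDl size_polyXn // ltnS size_low. Qed.

Lemma monic_of_monic m u : @monic_of m u \is monic.
Proof. by rewrite monicE lead_coefDl ?lead_coefXn // size_polyXn ltnS size_low. Qed.

Lemma coef_monic_of m u (i : 'I_m) : (@monic_of m u)`_i = u i.
Proof.
rewrite coefD coefXn ltn_eqF // add0r coef_sum (bigD1 i) //= big1 => [|k ki].
  by rewrite coefZ coefXn eqxx mulr1 addr0.
by rewrite coefZ coefXn eq_sym [_ == _](negbTE ki) mulr0.
Qed.

Lemma low_coefsK m u : low_coefs m (@monic_of m u) = u.
Proof. by apply/ffunP => i; rewrite ffunE coef_monic_of. Qed.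

Lemma monic_ofK m (g : {poly F}) :
  g \is monic -> size g = m.+1 -> monic_of (low_coefs m g) = g.
Proof.
move=> mong szg; apply/polyP => i; have [im|] := ltnP i m.
  by rewrite -[i]/(val (Ordinal im)) coef_monic_of ffunE.
rewrite leq_eqVlt => /predU1P[<-|mi].
  have /monicP := monic_of_monic (low_coefs m g); move/monicP: mong.
  by rewrite !lead_coefE size_monic_of szg /= => -> ->.
by rewrite !nth_default ?size_monic_of ?szg.
Qed.

Lemma big_monic_multiples (R : nmodType) m j (w : {poly F}) (Phi : {poly F} -> R) :
  w \is monic -> size w = j.+1 -> (j <= m)%N ->
  \sum_(v : {ffun 'I_(m - j) -> F}) Phi (w * monic_of v) =
  \sum_(u : {ffun 'I_m -> F} | w %| monic_of u) Phi (monic_of u).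
Proof.
move=> monw szw jm; have w_neq0 := monic_neq0 monw.
have mulK v : monic_of (low_coefs m (w * monic_of v)) = w * @monic_of (m - j) v.
  rewrite monic_ofK ?rpredM ?monic_of_monic //.
  by rewrite size_Mmonic ?monic_of_monic // szw size_monic_of addnS addSn subnKC.
rewrite [RHS](reindex (fun v : {ffun 'I_(m - j) -> F} => low_coefs m (w * monic_of v))) /=.
  apply: eq_big => [v|v _]; last by rewrite mulK.
  by rewrite mulK dvdp_mulr.
exists (fun u => low_coefs (m - j) (monic_of u %/ w)) => [v _|u].
  by rewrite mulK mulrC mulpK // low_coefsK.
rewrite inE => /divpK wu; have wq_neq0 : monic_of u %/ w != 0.
  by apply: contraTneq (monic_neq0 (monic_of_monic u)) => q0; rewrite -wu q0 mul0r eqxx.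
have monq : monic_of u %/ w \is monic.
  by rewrite -(monicMr _ monw) wu monic_of_monic.
have szq : size (monic_of u %/ w) = (m - j).+1.
  by rewrite size_divp // size_monic_of szw /= subSn.
by rewrite monic_ofK // mulrC wu low_coefsK.
Qed.

End MonicPolynomials.

Section LFunction.

Variables (K : closedFieldType) (p : nat) (charKp : p \in [pchar K]).
Variables (zeta : algC) (zetaP : p.-primitive_root zeta).
Variables (F : finFieldType) (incl : {rmorphism F -> K}) (r : nat).
Hypotheses (r_gt0 : (0 < r)%N) (cardF : #|F| = (p ^ r)%N).
Variable f : {poly F}.

Local Notation phi := (qfrob r charKp).
Local Notation fK := (map_poly incl f).
Local Notation Tr := (abs_trace p r).

Lemma qfrob_image a : phi (incl a) = incl a.
Proof. by rewrite /qfrob -cardF -rmorphXn /= expf_card. Qed.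

Lemma qfrob_fixedP x : reflect (exists a, x = incl a) (phi x == x).
Proof.
apply: (iffP eqP) => [xq|[a ->]]; last exact: qfrob_image.
pose s := [seq incl a | a <- enum F].
have us : uniq s by rewrite map_inj_uniq ?enum_uniq //; apply: fmorph_inj.
have ss : {subset s <= frob_fixed K p r}.
  by move=> _ /mapP[a _ ->]; rewrite mem_frob_fixed //; apply/eqP/qfrob_image.
have [|_ ss'] := uniq_min_size us ss.
  by rewrite size_frob_fixed // size_map -cardT cardF.
have : x \in frob_fixed K p r by rewrite mem_frob_fixed //; apply/eqP.
by rewrite -ss' => /mapP[a _ ->]; exists a.
Qed.

Lemma qfrob_stable_map (g : {poly F}) : qfrob_stable charKp r (map_poly incl g).
Proof.
by apply/eqP/polyP => i; rewrite !coef_map /= qfrob_image.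
Qed.

Lemma qfrob_stableP (g : {poly K}) :
  qfrob_stable charKp r g -> exists h : {poly F}, g = map_poly incl h.
Proof.
move=> /eqP sg; have /fin_all_exists [a aE] (i : 'I_(size g)) : exists a, g`_i = incl a.
  by apply/qfrob_fixedP; have := congr1 (fun h : {poly K} => h`_i) sg; rewrite coef_map => ->.
exists (\poly_(i < size g) (if insub i is Some k then a k else 0)).
apply/polyP => i; rewrite coef_map coef_poly; case: ltnP => ig /=.
  by rewrite insubT /= -aE.
by rewrite rmorph0 nth_default.
Qed.

Definition root_sum (g : {poly F}) : K :=
  \sum_(z <- proots (map_poly incl g)) fK.[z].

(* The analogue of a Dirichlet character, with L-function [sum_m lcoef m X^m]. *)
Definition lchar (g : {poly F}) : algC := psi p zeta (Tr (root_sum g)).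

(** [phi] permutes the roots of [g] with their multiplicities and commutes with evaluating [f]. *)
Lemma root_sum_fixed g : g \is monic -> phi (root_sum g) = root_sum g.
Proof.
move=> mong; have mongK : map_poly incl g \is monic by rewrite map_monic.
rewrite /root_sum rmorph_sum /=.
under eq_bigr => z _ do rewrite -horner_map (eqP (qfrob_stable_map f)).
rewrite -[LHS](big_map phi xpredT (fun z => fK.[z])); apply: perm_big.
apply: prod_XsubC_eq; rewrite proots_monic // big_map.
rewrite -[RHS](eqP (qfrob_stable_map g)) -[in RHS](proots_monic mongK) rmorph_prod /=.
by apply: eq_bigr => z _; rewrite map_polyXsubC.
Qed.

Lemma psi_trD (x y : K) : phi x = x -> phi y = y ->
  psi p zeta (Tr (x + y)) = psi p zeta (Tr x) * psi p zeta (Tr y).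
Proof.
by move=> xq yq; rewrite abs_traceD // (psiD charKp zetaP) ?abs_trace_expr.
Qed.

Lemma lcharM g h : g \is monic -> h \is monic -> lchar (g * h) = lchar g * lchar h.
Proof.
move=> mong monh; rewrite /lchar -psi_trD ?root_sum_fixed //; congr (psi _ _ (Tr _)).
have mongK : map_poly incl g \is monic by rewrite map_monic.
have monhK : map_poly incl h \is monic by rewrite map_monic.
rewrite /root_sum -big_cat; apply: perm_big; apply: prod_XsubC_eq.
by rewrite big_cat /= !proots_monic // rmorphM //= rpredM.
Qed.

(** The roots of [w] are the conjugates of [x], so summing [f] over them and taking the trace is the
    trace from the extension of degree [j]. *)
Lemma lchar_orbit (w : {poly F}) j x : iter j phi x = x ->
  map_poly incl w = orbit_poly charKp r j x ->
  lchar w = psi p zeta (abs_trace p (r * j) fK.[x]).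
Proof.
move=> xj wE; rewrite /lchar abs_trace_mul //; congr (psi _ _ (Tr _)).
rewrite /root_sum wE.
transitivity (\sum_(z <- [seq iter i phi x | i <- iota 0 j]) fK.[z]).
  apply: perm_big; apply: prod_XsubC_eq.
  by rewrite proots_monic ?orbit_poly_monic // orbit_poly_seq.
rewrite big_map -{1}[j]subn0 -/(index_iota 0 j) big_mkord; apply: eq_bigr => i _.
rewrite -expnM -iter_qfrob; elim: (val i) => //= k <-.
by rewrite -horner_map (eqP (qfrob_stable_map f)).
Qed.

Definition lcoef m : algC := \sum_(u : {ffun 'I_m -> F}) lchar (monic_of u).

Lemma lcoef0 : lcoef 0 = 1.
Proof.
rewrite /lcoef (eq_bigr (fun=> 1)) => [|u _].
  by rewrite sumr_const card_ffun card_ord expn0.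
rewrite /lchar /root_sum (_ : proots _ = [::]) ?big_nil ?abs_trace0 ?(psi0 charKp zetaP) //.
apply/size0nil/eqP; rewrite -eqSS -size_proots ?map_monic ?monic_of_monic //.
by rewrite size_map_poly size_monic_of.
Qed.

(** The factor [m] is written as the number of pairs [(j, x)] whose orbit polynomial divides the
    given monic polynomial. Exchanging sums and splitting off that divisor by multiplicativity gives
    the right side, a logarithmic derivative. *)
Lemma lcoef_recursion m :
  m%:R * lcoef m = \sum_(j < m) charsum p zeta (r * j.+1) fK * lcoef (m - j.+1).
Proof.
transitivity (\sum_(j < m) \sum_(x <- frob_fixed K p (r * j.+1))
    \sum_(u : {ffun 'I_m -> F} | orbit_poly charKp r j.+1 x %| map_poly incl (monic_of u))
      lchar (monic_of u)); last first.
  apply: eq_bigr => j _; rewrite /charsum mulr_suml big_seq [RHS]big_seq.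
  apply: eq_bigr => x; rewrite mem_frob_fixed ?muln_gt0 ?r_gt0 // => /eqP xj.
  have {}xj : iter j.+1 phi x = x by rewrite iter_qfrob.
  have [w wE] := qfrob_stableP (orbit_poly_stable xj).
  have monw : w \is monic by rewrite -(map_monic incl) -wE orbit_poly_monic.
  have szw : size w = j.+2 by rewrite -(size_map_poly incl) -wE size_orbit_poly.
  rewrite -(lchar_orbit xj (esym wE)) /lcoef mulr_sumr.
  under [RHS]eq_bigr => v _ do rewrite -lcharM ?monic_of_monic //.
  rewrite (big_monic_multiples lchar monw szw) //; apply: eq_bigl => u.
  by rewrite wE dvdp_map.
under eq_bigr do under eq_bigr do rewrite big_mkcond.
under eq_bigr do rewrite exchange_big /=.
rewrite exchange_big /= /lcoef mulr_sumr; apply: eq_bigr => u _.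
have sg := qfrob_stable_map (monic_of u).
have mong : map_poly incl (monic_of u) \is monic by rewrite map_monic monic_of_monic.
have szg : size (map_poly incl (monic_of u)) = m.+1 by rewrite size_map_poly size_monic_of.
rewrite -{1}(mem_orbit_divisors r_gt0 sg mong szg) natr_sum mulr_suml.
apply: eq_bigr => j _; rewrite -big_mkcond big_const_seq iter_addr addr0 mulr_natl.
by congr (_ *+ _); apply: eq_count.
Qed.

(** As a polynomial the trace has degree [p ^ r.-1], too small to vanish on all of [F]. *)
Lemma abs_trace_nonzero : exists t, Tr (incl t) != 0.
Proof.
apply/existsP; apply: contraT; rewrite negb_exists => /forallP Tr0.
pose P := \sum_(i < r) 'X^(p ^ i) : {poly K}.
have p_gt1 : (1 < p)%N by rewrite prime_gt1 // (pcharf_prime charKp).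
have szP : size P = (p ^ r.-1).+1.
  rewrite /P -(prednK r_gt0) big_ord_recr /= addrC size_polyDl size_polyXn //= ltnS.
  apply: (leq_trans (size_sum _ _ _)); apply/bigmax_leqP => i _.
  by rewrite size_polyXn ltn_exp2l.
have P_neq0 : P != 0 by rewrite -size_poly_gt0 szP.
have : all (root P) [seq incl a | a <- enum F].
  apply/allP => _ /mapP[a _ ->]; rewrite rootE horner_sum.
  by under eq_bigr do rewrite hornerXn; have := Tr0 a; rewrite negbK.
move/(max_poly_roots P_neq0); rewrite map_inj_uniq ?enum_uniq; last exact: fmorph_inj.
rewrite szP size_map -cardT cardF ltnS => /(_ isT); rewrite leq_exp2l // leqNgt.
by rewrite prednK ?leqnn.
Qed.

Lemma psi_tr_nontrivial a : a != 0 -> exists t, psi p zeta (Tr (incl (a * t))) != 1.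
Proof.
move=> a_neq0; have [t trt] := abs_trace_nonzero; exists (a^-1 * t).
rewrite mulVKf //; have : Tr (incl t) ^+ p == Tr (incl t).
  by apply/eqP/(abs_trace_expr charKp)/qfrob_image.
case/(prime_subfieldP charKp) => b bE; rewrite bE (psi_nat charKp zetaP) in trt *.
rewrite -(prim_order_dvd zetaP); apply: contra trt => pb.
by rewrite -(dvdn_pcharf charKp).
Qed.

(** The coefficient of index [m - d] is the symmetric function of order [d.+1] up to sign. It leaves
    the lower power sums unchanged and enters the top one linearly. *)
Lemma root_sum_perturb d m (g h : {poly F}) : size f = d.+2 ->
  g \is monic -> h \is monic -> size g = m.+2 -> size h = m.+2 -> (d <= m)%N ->
  (forall i, i != (m - d)%N -> g`_i = h`_i) ->
  root_sum g - root_sum h = incl (- (d.+1%:R * f`_d.+1 * (g`_(m - d) - h`_(m - d)))).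
Proof.
move=> szf mong monh szg szh dm gh.
set rg := proots (map_poly incl g); set rh := proots (map_poly incl h).
have mongK : map_poly incl g \is monic by rewrite map_monic.
have monhK : map_poly incl h \is monic by rewrite map_monic.
have szrg : size rg = m.+1 by apply/eqP; rewrite -eqSS -size_proots // size_map_poly szg.
have szrh : size rh = m.+1 by apply/eqP; rewrite -eqSS -size_proots // size_map_poly szh.
have Eg k : (k <= m.+1)%N -> (rev_prod rg)`_k = incl g`_(m.+1 - k).
  by move=> km; rewrite coef_rev_prodE szrg // proots_monic // coef_map.
have Eh k : (k <= m.+1)%N -> (rev_prod rh)`_k = incl h`_(m.+1 - k).
  by move=> km; rewrite coef_rev_prodE szrh // proots_monic // coef_map.
have [|low top] := @power_sum_perturb _ rg rh d.
  move=> k kd; have km : (k <= m.+1)%N by lia.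
  by rewrite Eg // Eh // gh //; apply/eqP; lia.
rewrite Eg // Eh // subSS -rmorphB /= in top.
have fE (s : seq K) : \sum_(z <- s) fK.[z] =
    \sum_(i < d.+2) incl f`_i * \sum_(z <- s) z ^+ i.
  under eq_bigr do rewrite horner_coef size_map_poly szf.
  rewrite exchange_big /=; apply: eq_bigr => i _; rewrite mulr_sumr.
  by apply: eq_bigr => z _; rewrite coef_map.
rewrite /root_sum -/rg -/rh !fE -sumrB big_ord_recr /= -mulrBr top big1 ?add0r.
  by rewrite rmorphN !rmorphM rmorph_nat /=; ring.
case=> [[|i] ilt] _ /=; rewrite -mulrBr.
  by rewrite !big_const_seq !count_predT szrg szrh subrr mulr0.
by rewrite low ?subrr ?mulr0.
Qed.

(** Translating the coefficient of index [m - d] by a suitable [t] permutes the monic polynomials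
    and multiplies every [lchar] by the same [chi != 1]. *)
Lemma lcoef_vanish d m : size f = d.+2 -> d.+1%:R != 0 :> F -> (d <= m)%N ->
  lcoef m.+1 = 0.
Proof.
move=> szf d_neq0 dm.
have a_neq0 : - (d.+1%:R * f`_d.+1) != 0.
  rewrite oppr_eq0 mulf_neq0 // -[d.+1]/(d.+2.-1) -szf -lead_coefE lead_coef_eq0.
  by rewrite -size_poly_gt0 szf.
have [t] := psi_tr_nontrivial a_neq0.
set chi := psi _ _ _ => chi_neq1.
pose k0 : 'I_m.+1 := inord (m - d).
have k0E : k0 = (m - d)%N :> nat by rewrite inordK // ltnS leq_subr.
pose shift t (u : {ffun 'I_m.+1 -> F}) := [ffun i => u i + (i == k0)%:R * t].
have shiftK : cancel (shift t) (shift (- t)).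
  by move=> u; apply/ffunP => i; rewrite !ffunE mulrN addrK.
have shiftK' : cancel (shift (- t)) (shift t).
  by move=> u; apply/ffunP => i; rewrite !ffunE mulrN subrK.
have shift_coef u i : (monic_of (shift t u))`_i = (monic_of u)`_i + (i == (m - d)%N)%:R * t.
  have [im|] := ltnP i m.+1.
    by rewrite -[i]/(val (Ordinal im)) !coef_monic_of ffunE -k0E.
  rewrite leq_eqVlt => /predU1P[<-|mi].
    rewrite (@gtn_eqF (m - d)) ?ltnS ?leq_subr // mul0r addr0.
    have /monicP := monic_of_monic u; have /monicP := monic_of_monic (shift t u).
    by rewrite !lead_coefE !size_monic_of /= => -> ->.
  rewrite !nth_default ?size_monic_of // gtn_eqF ?mul0r ?addr0 //; lia.
have : lcoef m.+1 = lcoef m.+1 * chi.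
  rewrite {1}/lcoef (reindex (shift t)) /=; last by exists (shift (- t)) => u _.
  rewrite /lcoef mulr_suml; apply: eq_bigr => u _.
  have := root_sum_perturb szf (monic_of_monic (shift t u)) (monic_of_monic u)
    (size_monic_of _) (size_monic_of _) dm.
  rewrite shift_coef eqxx mul1r addrAC subrr add0r => /(_ _)/(canRL (subrK _)) rsE.
  rewrite /lchar rsE => [|i ik]; last by rewrite shift_coef (negbTE ik) mul0r addr0.
  by rewrite psi_trD ?root_sum_fixed ?monic_of_monic ?qfrob_image // mulrC -mulNr.
move/eqP; rewrite -subr_eq0 -{1}[lcoef _]mulr1 -mulrBr mulf_eq0 subr_eq0 [1 == _]eq_sym.
by rewrite (negbTE chi_neq1) orbF => /eqP.
Qed.

End LFunction.

(** * Weil's bound *)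

Section WeilBound.

Variables (K : closedFieldType) (p : nat) (charKp : p \in [pchar K]).
Variables (zeta : algC) (zetaP : p.-primitive_root zeta).
Variables (F : finFieldType) (incl : {rmorphism F -> K}) (r : nat).
Hypotheses (r_gt0 : (0 < r)%N) (cardF : #|F| = (p ^ r)%N).

Lemma charsum_base (f : {poly F}) :
  charsum p zeta (r * 1) (map_poly incl f) =
  \sum_a psi p zeta (abs_trace p r (incl f.[a])).
Proof.
rewrite /charsum muln1.
have ss : {subset [seq incl a | a <- enum F] <= frob_fixed K p r}.
  by move=> _ /mapP[a _ ->]; rewrite mem_frob_fixed // -cardF -rmorphXn expf_card.
have us : uniq [seq incl a | a <- enum F].
  by rewrite map_inj_uniq ?enum_uniq //; apply: fmorph_inj.
have [|_ ss'] := uniq_min_size us ss.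
  by rewrite size_frob_fixed // size_map -cardT cardF.
rewrite -(perm_big _ (uniq_perm us (frob_fixed_uniq charKp r_gt0) ss')) big_map.
by rewrite [LHS]big_enum; apply: eq_bigr => a _; rewrite horner_map.
Qed.

Theorem weil_bound (f : {poly F}) d : size f = d.+2 -> (d.+1 < p)%N ->
  `|\sum_a psi p zeta (abs_trace p r (incl f.[a]))| <= d%:R * sqrtC (p ^ r)%:R.
Proof.
move=> szf dp; have p_gt1 : (1 < p)%N by rewrite prime_gt1 // (pcharf_prime charKp).
have charFp : p \in [pchar F] by rewrite -(fmorph_pchar incl).
have d_neq0 : d.+1%:R != 0 :> F by rewrite -(dvdn_pcharf charFp) gtnNdvd.
pose s j := charsum p zeta (r * j) (map_poly incl f).
have [|ws szws wsP] := @power_sum_representation _ d (lcoef p zeta incl r f) s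
    (lcoef0 charKp zetaP incl r f) _ (lcoef_recursion charKp zetaP incl r_gt0 cardF f).
  by case=> // k dk; exact: (lcoef_vanish charKp zetaP incl r_gt0 cardF szf d_neq0).
(* For [k >= k0], the number [m = r * k - 1] exceeds [(p * d.+1 + 2) * d.+1], and [p ^ m > m], as
   Stepanov's method requires. *)
set q := (p ^ r)%N; pose k0 := (((p * d.+1 + 2) * d.+1).+2)%N.
have q_gt0 : (0 < q)%N by rewrite expn_gt0 ltnW.
(* The crude bound concerns only extensions of even degree [2 * k], hence the squares of the [w]. *)
have grow k : (k0 <= k)%N ->
    `|\sum_(w <- [seq w ^+ 2 | w <- ws]) w ^+ k| <= (2 * p * d.+1 + 1)%N%:R * q%:R ^+ k.
  move=> k0k; have k_gt0 : (0 < k)%N by apply: leq_trans k0k.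
  rewrite big_map; under eq_bigr do rewrite -exprM.
  rewrite -normrN -(prednK (_ : 0 < 2 * k)%N) ?muln_gt0 // -wsP prednK ?muln_gt0 //.
  pose m := (r * k).-1; have mE : m.+1 = (r * k)%N by rewrite prednK // muln_gt0 r_gt0.
  have rkE : (r * (2 * k) = m.+1 + m.+1)%N by rewrite mE mulnCA mul2n addnn.
  rewrite -natrX -natrM /q -expnM -mE /s rkE.
  apply: (stepanov_charsum charKp zetaP).
  - by rewrite size_map_poly.
  - by rewrite dp.
  - apply: leq_trans (ltn_expl m p_gt1); rewrite mE.
    apply: leq_trans (leq_pmull k r_gt0); exact: leq_trans (leqnSn _) k0k.
  move=> x; rewrite -rkE -(iter_qfrob charKp) => xE.
  rewrite -(iter_qfrob charKp) -[in RHS]xE.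
  elim: (2 * k)%N => //= i ->.
  by rewrite -horner_map (eqP (qfrob_stable_map charKp incl cardF f)).
have ws_le w : w \in ws -> `|w| <= sqrtC q%:R.
  move=> wws; have q_gt0C : 0 < q%:R :> algC by rewrite ltr0n.
  have := power_sum_growth q_gt0C grow (map_f (fun z => z ^+ 2) wws); rewrite normrX => w2.
  by rewrite -(ler_pXn2r (_ : 0 < 2)%N) ?nnegrE ?sqrtC_ge0 ?ler0n // sqrtCK.
rewrite -charsum_base -/(s 1%N) wsP normrN; apply: le_trans (ler_norm_sum _ _ _) _.
rewrite -szws -sum1_size natr_sum mulr_suml big_seq [X in _ <= X]big_seq.
by apply: ler_sum => w /ws_le; rewrite expr1 mul1r.
Qed.

End WeilBound.

(** * The sum of digits as a trace *)

Section DigitSum.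

Variables (p r : nat) (F : finFieldType) (charFp : p \in [pchar F]).
Variable b : r.-tuple (pPrimeCharType charFp).

Let p_pr : prime p. Proof. exact: pcharf_prime charFp. Qed.

Fact digit_sum_is_zmod_morphism : zmod_morphism (digit_sum b).
Proof.
move=> x y; rewrite /digit_sum -sumrB; apply: eq_bigr => i _.
exact: (raddfB (coord b i)).
Qed.

HB.instance Definition _ :=
  GRing.isZmodMorphism.Build F 'F_p (digit_sum b) digit_sum_is_zmod_morphism.

Lemma digit_sum_scale a x : digit_sum b (a%:R * x) = a%:R * digit_sum b x.
Proof. by rewrite !mulr_natl raddfMn. Qed.

Hypotheses (r_gt0 : (0 < r)%N) (cardF : #|F| = (p ^ r)%N) (b_basis : basis_of fullv b).
Variables (K : closedFieldType) (charKp : p \in [pchar K]) (incl : {rmorphism F -> K}).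

Lemma natr_Fp_modp n : ((n%:R : 'F_p) : nat)%:R = n%:R :> K.
Proof. by apply/eqP; rewrite val_Fp_nat // (natr_eq_pchar charKp) modn_mod. Qed.

Let basis_expand x : x = \sum_(j < r) (coord b j x : nat)%:R * b`_j :> F.
Proof. exact (coord_basis b_basis (memvf (x : pPrimeCharType charFp))). Qed.

(** Since the trace is nonzero, [gam] is determined by the traces of the [gam * b_j]. By cardinality
    every vector of traces occurs, in particular the one with all entries [1]. *)
Lemma digit_sum_trace : exists2 gam : F, gam != 0 &
  forall x, (digit_sum b x : nat)%:R = abs_trace p r (incl (gam * x)).
Proof.
have /fin_all_exists [A AP] (gj : F * 'I_r) :
    exists a : 'I_p, abs_trace p r (incl (gj.1 * b`_gj.2)) = a%:R.
  apply/(prime_subfieldP charKp)/eqP/(abs_trace_expr charKp).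
  by rewrite -cardF -rmorphXn expf_card.
have trE gam x : abs_trace p r (incl (gam * x)) =
    \sum_(j < r) (coord b j x : nat)%:R * (A (gam, j))%:R.
  rewrite {1}[x]basis_expand mulr_sumr rmorph_sum abs_trace_sum //=.
  apply: eq_bigr => j _; rewrite mulrCA rmorphM rmorph_nat abs_traceMn //.
  by rewrite -(AP (gam, j)).
pose Psi gam := [ffun j => A (gam, j)].
have Psi_inj : injective Psi.
  move=> g g' /ffunP gg'; apply/eqP; rewrite -subr_eq0; apply: contraT => d_neq0.
  have [t /eqP[]] := abs_trace_nonzero charKp incl r_gt0 cardF.
  rewrite -(mulVKf d_neq0 t) mulrBl rmorphB abs_traceB // !trE -sumrB.
  by apply: big1 => j _; have := gg' j; rewrite !ffunE => ->; rewrite subrr.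
have [|Phi PsiK PhiK] := inj_card_bij Psi_inj.
  by rewrite card_ffun !card_ord cardF.
pose one := Ordinal (prime_gt1 p_pr); pose gam := Phi [ffun=> one].
have A1 j : A (gam, j) = one.
  by have := congr1 (fun h : {ffun _ -> _} => h j) (PhiK [ffun=> one]); rewrite !ffunE.
exists gam => [|x].
  apply: contraTneq (oner_neq0 K) => gam0; rewrite negbK.
  have := AP (gam, Ordinal r_gt0); rewrite A1 gam0 /= mul0r rmorph0 abs_trace0 //.
  by move=> oneE; rewrite eq_sym [X in X == _]oneE.
rewrite trE; under eq_bigr do rewrite A1 mulr1.
have -> : digit_sum b x = (\sum_(j < r) (coord b j x : nat))%:R.
  rewrite natr_sum; apply: eq_bigr => j _; exact/esym/natr_Zp.
by rewrite natr_Fp_modp natr_sum.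
Qed.

End DigitSum.

(** * Counting *)

Lemma bin_pchar_neq0 (R : nzRingType) p d k : p \in [pchar R] -> (d < p)%N -> (k <= d)%N ->
  ('C(d, k))%:R != 0 :> R.
Proof.
move=> charRp dp kd; have p_pr := pcharf_prime charRp.
rewrite -(dvdn_pcharf charRp); apply: contraL (dp) => pC; rewrite -leqNgt.
have: (p %| d`!)%N by rewrite -(bin_fact kd) dvdn_mulr.
elim: (d) => [|n IHn]; first by rewrite fact0 dvdn1 => /eqP p1; rewrite p1 in p_pr.
by rewrite factS Euclid_dvdM // => /orP[/dvdn_leq->//|/IHn/leqW].
Qed.

Lemma coef_XaddC_exp (R : comNzRingType) (a : R) d k : (k <= d)%N ->
  (('X + a%:P) ^+ d)`_k = a ^+ (d - k) *+ 'C(d, k).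
Proof.
move=> kd; rewrite addrC exprDn coef_sum (bigD1 (Ordinal (_ : k < d.+1)%N)) //= big1 => [|i ik].
  by rewrite addr0 coefMn -rmorphXn coefCM coefXn eqxx mulr1.
rewrite coefMn -rmorphXn coefCM coefXn; case: eqP => [kE|]; last by rewrite mulr0 mul0rn.
by case/eqP: ik; apply/val_inj.
Qed.

Lemma size_XaddC_exp (R : idomainType) (a : R) d : size (('X + a%:P) ^+ d) = d.+1.
Proof.
have XaD : 'X + a%:P != 0 by rewrite -size_poly_gt0 size_XaddC.
by rewrite -(prednK (_ : 0 < size (('X + a%:P) ^+ d))%N) ?size_exp ?size_XaddC ?mul1n //
  size_poly_gt0 expf_neq0.
Qed.

(* The powers [('X + alpha_i)^d] are independent modulo the constants, by
   interpolation at the [alpha_i]. *)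
Lemma size_power_combination (F : fieldType) p d s (alpha : s.-tuple F) (y : 'I_s -> F) i :
  p \in [pchar F] -> uniq alpha -> (s <= d < p)%N -> y i != 0 ->
  (1 < size (\sum_i y i *: ('X + (tnth alpha i)%:P) ^+ d)%R)%N.
Proof.
move=> charFp ualpha /andP[sd dp] yi; rewrite ltnNge; apply: contra yi => sz1.
(* The coefficient of index [d - j] is this moment times ['C(d, j)], which is invertible because
   [d < p]. *)
have moments j : (j < d)%N -> \sum_i y i * tnth alpha i ^+ j = 0.
  move=> jd; have := leq_sizeP _ _ sz1 (d - j)%N; rewrite subn_gt0 => /(_ jd).
  rewrite coef_sum; under eq_bigr => k _ do
    rewrite coefZ coef_XaddC_exp ?leq_subr // subKn ?(ltnW jd) // mulrnAr -mulr_natr.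
  rewrite -mulr_suml => /eqP; rewrite mulf_eq0 => /orP[/eqP//|].
  by rewrite (negbTE (bin_pchar_neq0 charFp dp _)) // leq_subr.
(* Of degree [s - 1 < d], [h] pairs with the moments and keeps only the term of [alpha_i]. *)
pose h := \prod_(x <- rem (tnth alpha i) alpha) ('X - x%:P).
have szh : (size h <= d)%N.
  by rewrite size_prod_XsubC size_rem ?mem_tnth // size_tuple prednK // (leq_trans _ (ltn_ord i)).
have hroot x : root h x = (x != tnth alpha i) && (x \in tval alpha).
  by rewrite root_prod_XsubC mem_rem_uniq // inE.
have : \sum_k y k * h.[tnth alpha k] = 0.
  under eq_bigr do rewrite horner_coef mulr_sumr.
  rewrite exchange_big /= big1 // => j _.
  under eq_bigr do rewrite mulrCA.
  by rewrite -mulr_sumr moments ?mulr0 // (leq_trans (ltn_ord j)).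
rewrite (bigD1 i) //= big1 ?addr0 => [|k ki]; last first.
  suff /rootP-> : root h (tnth alpha k) by rewrite mulr0.
  by rewrite hroot mem_tnth andbT (inj_eq (tuple_uniqP _ ualpha)).
move/eqP; rewrite mulf_eq0 => /orP[//|].
by rewrite -rootE hroot eqxx.
Qed.

Section Count.

Variables (p r s d : nat) (F : finFieldType) (charFp : p \in [pchar F]).
Variable b : r.-tuple (pPrimeCharType charFp).
Hypotheses (r_gt0 : (0 < r)%N) (cardF : #|F| = (p ^ r)%N) (b_basis : basis_of fullv b).
Variables (alpha : s.-tuple F) (c : s.-tuple 'F_p).
Hypotheses (sd : (s <= d)%N) (dp : (d < p)%N) (ualpha : uniq alpha).

Let p_pr : prime p. Proof. exact: pcharf_prime charFp. Qed.
Let p_gt0 : (0 < p)%N. Proof. exact: prime_gt0. Qed.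

Let T i xi : nat := digit_sum b ((xi + tnth alpha i) ^+ d).
(** A natural number representing [T - c_i] modulo [p], usable as an exponent of [zeta]. *)
Let k i xi : nat := (T i xi + (p - tnth c i))%N.

Let ltFp (a : 'F_p) : (a < p)%N.
Proof. by rewrite -[X in (_ < X)%N](Fp_cast p_pr). Qed.

Let k_dvd i xi : (p %| k i xi)%N = (digit_sum b ((xi + tnth alpha i) ^+ d) == tnth c i).
Proof.
rewrite (dvdn_pcharf (pchar_Fp p_pr)) natrD natrB; last exact/ltnW/ltFp.
by rewrite (pcharf0 (pchar_Fp p_pr)) sub0r /T !natr_Zp subr_eq0.
Qed.

(** Each condition is detected by a sum over the [p] characters. The zero vector [y0] contributes
    exactly [p ^ r], and every other [y], of which there are fewer than [p ^ s], falls under Weil's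
    bound. *)
Lemma thue_morse_count :
  `|(p ^ s * #|thue_morse_set b c alpha 'X^d|)%N%:R - (p ^ r)%N%:R| <=
  (p ^ s)%N%:R * (d.-1%:R * sqrtC (p ^ r)%N%:R) :> algC.
Proof.
have [zeta zetaP] := C_prim_root_exists p_gt0.
have [K [incl _]] := countable_algebraic_closure F.
have charKp : p \in [pchar K] by rewrite (fmorph_pchar incl).
have [gam gam_neq0 gamP] := digit_sum_trace r_gt0 cardF b_basis charKp incl.
set N := #|_|; set q := (p ^ r)%N.
have geom n : \sum_(y < p) (zeta ^+ n) ^+ y = (p * (p %| n))%N%:R.
  have [pn|pn] := boolP (p %| n)%N.
    rewrite muln1 (eq_bigr (fun=> 1)) ?sumr_const ?card_ord // => y _.
    by move: pn; rewrite (prim_order_dvd zetaP) => /eqP->; rewrite expr1n.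
  rewrite muln0; have := subrX1 (zeta ^+ n) p.
  rewrite exprAC (prim_expr_order zetaP) expr1n subrr => /esym/eqP.
  by rewrite mulf_eq0 subr_eq0 -(prim_order_dvd zetaP) (negbTE pn) => /eqP.
have NE : (p ^ s * N)%N%:R =
    \sum_(y : {ffun 'I_s -> 'I_p}) \sum_xi zeta ^+ (\sum_i k i xi * y i) :> algC.
  rewrite exchange_big /= /N -sum1_card big_distrr /= natr_sum big_mkcond /=.
  apply: eq_bigr => xi _.
  transitivity (\prod_(i < s) \sum_(y < p) (zeta ^+ k i xi) ^+ y); last first.
    rewrite bigA_distr_bigA; apply: eq_bigr => y _; rewrite expr_sum.
    by apply: eq_bigr => i _; rewrite exprM.
  under [RHS]eq_bigr do rewrite geom k_dvd.
  rewrite inE muln1; case: forallP => [tm|ntm].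
    rewrite (eq_bigr (fun=> p%:R)) => [|i _]; first by rewrite prodr_const card_ord natrX.
    by have := tm i; rewrite hornerXn => ->; rewrite muln1.
  apply/esym/eqP; rewrite prodf_seq_eq0; apply/hasP.
  have /forallPn[i ti] : ~~ [forall i, digit_sum b ('X^d).[xi + tnth alpha i] == tnth c i].
    exact/forallP.
  exists i; first exact: mem_index_enum.
  by move: ti; rewrite hornerXn => /negbTE tiE; rewrite /= tiE muln0 eqxx.
pose y0 : {ffun 'I_s -> 'I_p} := [ffun=> Ordinal p_gt0].
rewrite NE (bigD1 y0) //= (eq_bigr (fun=> 1)) => [|xi _]; last first.
  by rewrite big1 ?expr0 // => i _; rewrite ffunE muln0.
rewrite sumr_const cardF addrAC subrr add0r.
apply: le_trans (ler_norm_sum _ _ _) _.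
have Sy y : y != y0 ->
    `|\sum_xi zeta ^+ (\sum_i k i xi * y i)| <= d.-1%:R * sqrtC q%:R.
  move=> yy0.
  have [i yi] : exists i, (y i)%:R != 0 :> F.
    apply/existsP; apply: contraR yy0; rewrite negb_exists => /forallP y_0.
    apply/eqP/ffunP => i; apply/val_inj; rewrite ffunE /=; apply/eqP.
    have := y_0 i; rewrite negbK -[0]/(0%:R) (natr_eq_pchar charFp).
    by rewrite !modn_small.
  pose g := gam *: \sum_i (y i)%:R *: ('X + (tnth alpha i)%:P) ^+ d.
  have szg_gt1 : (1 < size g)%N.
    rewrite size_scale //.
    by apply: (size_power_combination (y := fun i => (y i)%:R) charFp ualpha _ yi); rewrite sd.
  have szg_le : (size g <= d.+1)%N.
    rewrite size_scale //; apply: (leq_trans (size_sum _ _ _)); apply/bigmax_leqP => j _.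
    by rewrite (leq_trans (size_scale_leq _ _)) // size_XaddC_exp.
  (* The degree [e.+1] lies between [1] and [d], so the constant [e] in Weil's bound is at most
     [d.-1]. *)
  have [e szg] : exists e, size g = e.+2 by exists (size g).-2; lia.
  have psiE xi : psi p zeta (abs_trace p r (incl g.[xi])) = zeta ^+ (\sum_i T i xi * y i).
    rewrite hornerZ -gamP.
    have -> : digit_sum b (\sum_i (y i)%:R *: ('X + (tnth alpha i)%:P) ^+ d).[xi] =
        (\sum_i T i xi * y i)%N%:R.
      rewrite horner_sum raddf_sum natr_sum /=; apply: eq_bigr => j _.
      rewrite hornerZ horner_exp hornerD hornerX hornerC.
      by rewrite digit_sum_scale natrM mulrC /T natr_Zp.
    by rewrite (natr_Fp_modp charFp charKp) (psi_nat charKp zetaP).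
  have -> : \sum_xi zeta ^+ (\sum_i k i xi * y i) =
      zeta ^+ (\sum_i (p - tnth c i) * y i) *
      \sum_xi psi p zeta (abs_trace p r (incl g.[xi])).
    rewrite mulr_sumr; apply: eq_bigr => xi _; rewrite psiE -exprD; congr (_ ^+ _).
    by rewrite -big_split /=; apply: eq_bigr => j _; rewrite -mulnDl addnC.
  rewrite normrM normrX (norm_zeta charKp zetaP) expr1n mul1r.
  apply: le_trans (weil_bound charKp zetaP incl r_gt0 cardF szg _) _; first by lia.
  by rewrite ler_wpM2r ?sqrtC_ge0 ?ler0n // ler_nat; lia.
apply: (@le_trans _ _ (\sum_(y : {ffun 'I_s -> 'I_p} | y != y0) d.-1%:R * sqrtC q%:R)).
  exact: ler_sum.
rewrite sumr_const -[X in X <= _]mulr_natl ler_wpM2r ?mulr_ge0 ?sqrtC_ge0 ?ler0n // ler_nat.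
by apply: leq_trans (max_card _) _; rewrite card_ffun !card_ord.
Qed.

End Count.

(* Squaring turns the bound into an inequality between integers. *)
Lemma sqrtC_bound_transfer (R : rcfType) (a q m : nat) :
  `|a%:R - q%:R| <= m%:R * sqrtC q%:R :> algC ->
  `|a%:R - q%:R| <= m%:R * Num.sqrt q%:R :> R.
Proof.
have intE (C : pzRingType) : a%:R - q%:R = (a%:Z - q%:Z)%:~R :> C by rewrite rmorphB.
move=> leC; have {}leC : ((a%:Z - q%:Z) ^+ 2 <= (m ^ 2 * q)%:Z)%R.
  rewrite -(ler_int algC) rmorphXn /= -intE -real_normK ?realB ?realn //.
  rewrite -[X in _ <= X]/((m ^ 2 * q)%:R) natrM natrX -[q%:R in X in _ <= X]sqrtCK -exprMn.
  by rewrite ler_pXn2r ?nnegrE ?mulr_ge0 ?sqrtC_ge0 ?ler0n.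
rewrite -(ler_pXn2r (_ : 0 < 2)%N) ?nnegrE ?mulr_ge0 ?sqrtr_ge0 ?ler0n //.
rewrite exprMn sqr_sqrtr ?ler0n // real_normK ?num_real // intE -rmorphXn /=.
by rewrite -natrX -natrM -[X in _ <= X]/((m ^ 2 * q)%:Z%:~R) ler_int.
Qed.

(** * An empty pattern when there are more than [d] shifts *)

Lemma thue_morse_empty (p r d s : nat) (F : finFieldType) (charFp : p \in [pchar F])
    (b : r.-tuple (pPrimeCharType charFp)) :
  (d < p)%N -> (d < s <= #|F|)%N ->
  exists (alpha : s.-tuple F) (c : s.-tuple 'F_p),
    uniq alpha /\ thue_morse_set b c alpha 'X^d = set0.
Proof.
move=> dp /andP[ds sq]; have p_pr := pcharf_prime charFp.
have uniq_nat (R : nzRingType) : p \in [pchar R] -> uniq [seq (i%:R : R) | i <- iota 0 d.+1].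
  move=> charRp; rewrite map_inj_in_uniq ?iota_uniq // => i j; rewrite !mem_iota /= => id jd.
  by move/eqP; rewrite (natr_eq_pchar charRp) !modn_small => [/eqP||]; lia.
pose l0 : seq F := [seq i%:R | i <- iota 0 d.+1].
have ul0 : uniq l0 by apply: uniq_nat.
(* The shifts [0, ..., d] come first; the remaining elements of [F] pad the list up to length
   [s]. *)
pose l := l0 ++ [seq x <- enum F | x \notin l0].
have ul : uniq l.
  rewrite cat_uniq ul0 filter_uniq ?enum_uniq // andbT.
  by apply/hasPn => x; rewrite mem_filter => /andP[].
have szl : (s <= size l)%N.
  apply: leq_trans sq _; rewrite cardE; apply: uniq_leq_size; first exact: enum_uniq.
  by move=> x _; rewrite mem_cat mem_filter mem_enum andbT orbN.
have szt : size (take s l) == s by rewrite size_takel.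
pose alpha : s.-tuple F := Tuple szt.
have alphaE (i : 'I_s) : (i <= d)%N -> tnth alpha i = i%:R.
  move=> id; rewrite (tnth_nth 0) /= nth_take // nth_cat size_map size_iota ltnS id.
  by rewrite (nth_map 0%N) ?size_iota // nth_iota.
(* Any value other than [T 1] would do; this one makes the top coefficient of [H] equal to [-1]. *)
pose t := digit_sum b 1 + 1.
exists alpha, [tuple t * i%:R ^+ d | i < s]; split; first exact: take_uniq.
apply/eqP; rewrite -subset0; apply/subsetP => xi; rewrite inE => /forallP xiP.
have {}xiP i : (i <= d)%N -> digit_sum b ((xi + i%:R) ^+ d) = t * i%:R ^+ d.
  move=> id; have is_ : (i < s)%N by apply: leq_ltn_trans ds.
  by have := xiP (Ordinal is_); rewrite tnth_mktuple hornerXn alphaE // => /eqP.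
(* By additivity of [T] and the binomial formula, [H] takes at [i] the difference between the actual
   and the prescribed value, so it would have [d + 1] roots in the prime field. *)
pose H := \sum_(k < d.+1) (digit_sum b (xi ^+ (d - k)) *+ 'C(d, k)) *: 'X^k - t *: 'X^d.
have HE i : H.[i%:R] = digit_sum b ((xi + i%:R) ^+ d) - t * i%:R ^+ d.
  rewrite hornerD hornerN hornerZ hornerXn horner_sum exprDn raddf_sum; congr (_ - _).
  apply: eq_bigr => k _; rewrite hornerZ hornerXn raddfMn /= -!natrX.
  by rewrite (mulrC (xi ^+ _)) digit_sum_scale [LHS]mulrC mulrnAr.
have szH : (size H <= d.+1)%N.
  rewrite (leq_trans (size_polyD _ _)) // geq_max size_polyN.
  rewrite (leq_trans (size_scale_leq _ _)) ?size_polyXn // andbT.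
  apply: (leq_trans (size_sum _ _ _)); apply/bigmax_leqP => k _.
  by rewrite (leq_trans (size_scale_leq _ _)) // size_polyXn.
have Hd : H`_d = -1.
  rewrite coefB coefZ coefXn eqxx mulr1 coef_sum big_ord_recr /= big1 => [|k _].
    by rewrite coefZ coefXn eqxx mulr1 subnn expr0 binn /t add0r opprD addrA subrr add0r.
  by rewrite coefZ coefXn gtn_eqF ?mulr0.
have H_neq0 : H != 0 by apply: contra_eq_neq Hd => ->; rewrite coef0 eq_sym oppr_eq0 oner_eq0.
have : all (root H) [seq (i%:R : 'F_p) | i <- iota 0 d.+1].
  apply/allP => x /mapP[i]; rewrite mem_iota /= add0n ltnS => id ->.
  by rewrite rootE HE xiP // subrr.
move/(max_poly_roots H_neq0)/(_ (uniq_nat _ (pchar_Fp p_pr))).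
by rewrite size_map size_iota ltnNge szH.
Qed.

Theorem corollary1 (R : rcfType) (p r d : nat) (F : finFieldType)
    (charFp : p \in [pchar F]) (b : r.-tuple (pPrimeCharType charFp)) :
  prime p -> (1 <= r)%N -> #|F| = (p ^ r)%N -> basis_of fullv b ->
  (1 <= d < p)%N ->
  (forall s : nat, (1 <= s <= d)%N ->
     forall (alpha : s.-tuple F) (c : s.-tuple 'F_p), uniq alpha ->
       `| #|thue_morse_set b c alpha 'X^d|%:R - (p%:R : R) ^ (r%:Z - s%:Z) |
         <= (d%:R - 1) * Num.sqrt ((p ^ r)%N%:R)) /\
  (forall s : nat, (d < s <= p ^ r)%N ->
     exists (alpha : s.-tuple F) (c : s.-tuple 'F_p),
       uniq alpha /\ thue_morse_set b c alpha 'X^d = set0).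
Proof.
move=> p_pr r_gt0 cardF b_basis /andP[d_gt0 dp]; split=> s; last first.
  by move=> ds; apply: thue_morse_empty; rewrite ?cardF.
move=> /andP[s_gt0 sd] alpha c ualpha.
have p_neq0 : (p%:R : R) != 0 by rewrite pnatr_eq0 -lt0n prime_gt0.
have ps_gt0 : 0 < (p ^ s)%N%:R :> R by rewrite ltr0n expn_gt0 prime_gt0.
have := thue_morse_count r_gt0 cardF b_basis c sd dp ualpha.
rewrite mulrA -natrM => /(sqrtC_bound_transfer R) le_ps.
(* Multiplying by [p ^ s] turns the possibly fractional [p ^ (r - s)] into [p ^ r]. *)
rewrite -(ler_pM2l ps_gt0) -{1}(gtr0_norm ps_gt0) -normrM mulrBr -natrM.
rewrite expfzDr // -exprnN -[p%:R ^ r]/(p%:R ^+ r) -!natrX mulrCA divff ?gt_eqF // mulr1.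
rewrite mulrA [X in _ <= X * _](_ : _ = (p ^ s * d.-1)%N%:R) //.
by rewrite natrM; congr (_ * _); rewrite -[in d%:R](prednK d_gt0) -natr1 addrK.
Qed.
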